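(* Let $\phi_1,\phi_2$ be distinct inner functions on $\mathbb{D}$ with $\phi=\gcd(\phi_1,\phi_2)$. Then the truncated Toeplitz operator $T_{\phi_1}^{\phi_2}$ on $\mathcal{K}_{\phi_2}$ has finite rank if and only if $\phi_2/\phi$ is a finite Blaschke product.
   Context: $\mathbb{D}$ is the open unit disc, $\mathbb{T}$ the unit circle, $H^2$ the Hardy space of $\mathbb{D}$. An inner function is a bounded analytic function $\phi$ on $\mathbb{D}$ with $|\phi|=1$ a.e. on $\mathbb{T}$. For an inner function $\theta$, $\mathcal{K}_\theta=H^2\ominus\theta H^2$, and for inner (bounded) $\psi$ the truncated Toeplitz operator $T_\psi^\theta:\mathcal{K}_\theta\to\mathcal{K}_\theta$ is $T_\psi^\theta f=P_{\mathcal{K}_\theta}(\psi f)$, with $P_{\mathcal{K}_\theta}$ the orthogonal projection onto $\mathcal{K}_\theta$. $\gcd(\phi_1,\phi_2)$ is the greatest inner function dividing both $\phi_1$ and $\phi_2$ (a common inner divisor divisible by every common inner divisor), unique up to a unimodular constant. A finite Blaschke product is a function $\zeta\prod_{i=1}^n\frac{z-a_i}{1-\overline{a_i}z}$ with $\zeta\in\mathbb{T}$, $n\ge 0$, $a_i\in\mathbb{D}$ (unimodular constants are included, $n=0$). *)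

(* Defs.v *)
From HB Require Import structures.
From mathcomp Require Import all_boot all_order all_algebra.
From mathcomp Require Import all_classical all_reals all_analysis.
From mathcomp Require Import complex.
Set Implicit Arguments.
Unset Strict Implicit.
Unset Printing Implicit Defensive.
Import Order.TTheory GRing.Theory Num.Theory.
Import numFieldNormedType.Exports.
Local Open Scope classical_set_scope.
Local Open Scope ring_scope.
Local Open Scope complex_scope.

(* The topology of [R[i]] is the one of [R[i]^o], i.e. the one given by the
   modulus; this makes the notation [u @ \oo --> l] available on [R[i]]. *)
HB.instance Definition _ (R : realType) := NormedModule.copy R[i] R[i]^o.

Record disc (R : realType) := Disc {
  disc_val : R[i];
  disc_lt1 : `|disc_val| < 1
}.

HB.instance Definition _ (R : realType) := [isSub for @disc_val R].
HB.instance Definition _ (R : realType) := [Choice of disc R by <:].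

Lemma normc0_lt1 (R : realType) : `|0 : R[i]| < 1.
Proof. by rewrite normr0 ltr01. Qed.

Definition disc0 (R : realType) : disc R := Disc (normc0_lt1 R).

Definition analytic (R : realType) (f : disc R -> R[i]) : Prop :=
  forall z0 : disc R, exists2 e : R, 0 < e & exists a : nat -> R[i],
    forall z : disc R, `|disc_val z - disc_val z0| < e%:C ->
      series (fun k => a k * (disc_val z - disc_val z0) ^+ k) @ \oo --> f z.

(* The point r e^{it} of the disc. It is meaningful for 0 <= r < 1; the default
   value of [insubd] is irrelevant for limits at r -> 1^-. *)
Definition radial (R : realType) (t r : R) : disc R :=
  insubd (disc0 R) (r%:C * (cos t +i* sin t)).

(* The boundary function is given by radial limits, and almost everywhere on
   the circle means for almost every angle t in [0, 2 pi]. *)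
Definition inner (R : realType) (f : disc R -> R[i]) : Prop :=
  [/\ analytic f,
      exists M : R, forall z, `|f z| <= M%:C
    & {ae lebesgue_measure, forall t : R, t \in `[0, 2 * pi] ->
        exists2 w : R[i], `|w| = 1 & f (radial t r) @[r --> 1^'-] --> w}].

Definition power_series (R : realType) (a : nat -> R[i]) (f : disc R -> R[i])
    : Prop :=
  forall z : disc R, series (fun k => a k * disc_val z ^+ k) @ \oo --> f z.

Definition H2 (R : realType) : set (disc R -> R[i]) :=
  [set f | exists2 a : nat -> R[i],
     cvgn (series (fun k => Normc.normc (a k) ^+ 2)) & power_series a f].

Definition taylor (R : realType) (f : disc R -> R[i]) : nat -> R[i] :=
  xget (fun=> 0) [set a | power_series a f].

Definition H2_dot (R : realType) (f g : disc R -> R[i]) : R[i] :=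
  limn (series (fun k => taylor f k * (taylor g k)^*)).

Definition model_space (R : realType) (theta : disc R -> R[i])
    : set (disc R -> R[i]) :=
  [set f | H2 f /\ forall g, H2 g -> H2_dot f (theta \* g) = 0].

(* The vector h of the subspace K such that g - h is orthogonal to K. *)
Definition H2_proj (R : realType) (K : set (disc R -> R[i]))
    (g : disc R -> R[i]) : disc R -> R[i] :=
  xget 0 [set h | K h /\ forall k, K k -> H2_dot (g - h) k = 0].

Definition truncated_toeplitz (R : realType) (psi theta : disc R -> R[i])
    (f : disc R -> R[i]) : disc R -> R[i] :=
  H2_proj (model_space theta) (psi \* f).

(* The image of the subspace K under T has finite dimension. *)
Definition finite_rank_on (R : realType) (K : set (disc R -> R[i]))
    (T : (disc R -> R[i]) -> disc R -> R[i]) : Prop :=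
  exists (n : nat) (g : 'I_n -> disc R -> R[i]),
    T @` K = [set (fun z => \sum_(i < n) c i * g i z)
             | c in [set: 'I_n -> R[i]]].

Definition inner_divides (R : realType) (g f : disc R -> R[i]) : Prop :=
  exists2 h, inner h & f = g \* h.

Definition is_gcd (R : realType) (f f1 f2 : disc R -> R[i]) : Prop :=
  [/\ inner f, inner_divides f f1, inner_divides f f2
    & forall g, inner g -> inner_divides g f1 -> inner_divides g f2 ->
        inner_divides g f].

(* The quotient f / g of inner functions, where g divides f. Pointwise division
   would give the wrong value 0 at the zeros of g. *)
Definition inner_quot (R : realType) (f g : disc R -> R[i])
    : disc R -> R[i] :=
  xget 0 [set h | inner h /\ f = g \* h].

Definition finite_blaschke (R : realType) (b : disc R -> R[i]) : Prop :=
  exists (zeta : R[i]) (n : nat) (a : 'I_n -> disc R), `|zeta| = 1 /\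
    forall z : disc R,
      b z = zeta * \prod_(i < n)
        ((disc_val z - disc_val (a i)) / (1 - (disc_val (a i))^* * disc_val z)).

(* Main.v *)
(* Write phi1 = phi h1 and phi2 = phi h2. The projection of f onto K_phi2 is
   f - phi2 c, where c has the coefficients <f, phi2 z^n>; hence T k is the only
   element of K_phi2 congruent to phi1 k modulo phi2 H^2.

   If h2 is a finite Blaschke product with factors b_1, ..., b_n, then H^2 is the
   span of the partial products b_1 ... b_i plus h2 H^2, as f - f(a) is divisible
   by b_a. Applied to h1 k, this puts all values T k in the span of the projections
   of phi b_1 ... b_i.

   Conversely, if T has finite rank, the classes of phi1 z^j modulo phi2 H^2 are
   linearly dependent, so p h1 = h2 G for some nonzero polynomial p and G in H^2.
   Removing the roots of p one by one leaves h2 = B u and h1 = u w, where B is a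
   finite Blaschke product and u and w are inner. Then phi u divides phi1 and
   phi2, hence phi, and u is constant.

   All of this rests on the isometry |phi f| = |f| in H^2 for phi inner, which
   follows from Parseval's identity and dominated convergence of radial limits,
   once bounded analytic functions are known to be global power series. *)
Require Import Defs.
From mathcomp Require Import all_boot all_order all_algebra.
From mathcomp Require Import all_classical all_reals all_analysis.
From mathcomp Require Import measurable_realfun complex ring lra.
Set Implicit Arguments.
Unset Strict Implicit.
Unset Printing Implicit Defensive.
Import Order.TTheory GRing.Theory Num.Theory.
Import numFieldNormedType.Exports.
Local Open Scope classical_set_scope.
Local Open Scope ring_scope.
Local Open Scope complex_scope.

(** * Complex moduli and limits *)

(** Norms are computed on Taylor coefficients: [nsq] is the squared norm of H^2, and boundary values
    enter it only through radial limits of an inner function times a polynomial. Density of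
    polynomials, with explicit tails, carries the isometry to all of H^2, so no L^2 theory on the
    circle is needed. The isometry also allows inner factors to be cancelled without looking at
    their zeros ([inner_mulI]), and its polynomial form yields the bound that the maximum principle
    would give ([inner_le1]). The delicate point of the converse is a root [a] of p on the unit
    circle, since division by z - a is not bounded on H^2. The relation p h1 = h2 G helps: it reads
    (z - a) X = h2 G with X in H^2, and as multiplication by h2 is isometric, the approximants of G
    / (z - a) inherit a uniform bound from X. That w is inner, and not merely in H^2, follows from
    h1 = u w with u and h1 inner. *)

Notation normC := Normc.normc.

Section modulus.
Variable R : realType.
Implicit Types (z w : R[i]) (x : R).

Lemma normE z : `|z| = (normC z)%:C.
Proof. by case: z => a b; rewrite normc_def. Qed.

Lemma normC_ge0 z : 0 <= normC z.
Proof. by rewrite -lecR -normE normr_ge0. Qed.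

Lemma normCD z w : normC (z + w) <= normC z + normC w.
Proof. exact: (@le_normcD R z w). Qed.

Lemma normCN z : normC (- z) = normC z.
Proof. exact: (@normcN R z). Qed.

Lemma normCBC z w : normC (z - w) = normC (w - z).
Proof. by rewrite -normCN opprB. Qed.

Lemma normCB z w : normC (z - w) <= normC z + normC w.
Proof. by rewrite -(normCN w) normCD. Qed.

Lemma normCX z n : normC (z ^+ n) = normC z ^+ n.
Proof.
elim: n => [|n ih]; first by rewrite !expr0 Normc.normc1.
by rewrite !exprS Normc.normcM ih.
Qed.

Lemma normC_eq0 z : (normC z == 0) = (z == 0).
Proof.
by apply/eqP/eqP => [/Normc.eq0_normc //|->]; rewrite Normc.normc0.
Qed.

Lemma normC_real x : normC x%:C = `|x|.
Proof. by rewrite /= expr0n /= addr0 sqrtr_sqr. Qed.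

Lemma normCJ z : normC z^*%C = normC z.
Proof. by case: z => a b /=; rewrite sqrrN. Qed.

Lemma sqr_normCE z : normC z ^+ 2 = complex.Re z ^+ 2 + complex.Im z ^+ 2.
Proof. by case: z => a b /=; rewrite sqr_sqrtr // addr_ge0 ?sqr_ge0. Qed.

Lemma normC_sqrJ z : (normC z ^+ 2)%:C = z * z^*%C.
Proof. by rewrite -sqr_normc normE rmorphXn. Qed.

Lemma normRe_le z : `|complex.Re z| <= normC z.
Proof. by rewrite -lecR -normE normc_ge_Re. Qed.

Lemma normIm_le z : `|complex.Im z| <= normC z.
Proof.
by rewrite -(ler_pXn2r (isT : (0 < 2)%N)) ?nnegrE ?normC_ge0 ?normr_ge0//
  sqr_normCE real_normK ?num_real// lerDr sqr_ge0.
Qed.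

Lemma normC_leReIm z : normC z <= `|complex.Re z| + `|complex.Im z|.
Proof.
rewrite -(ler_pXn2r (isT : (0 < 2)%N)) ?nnegrE ?normC_ge0 ?addr_ge0//.
rewrite sqr_normCE sqrrD !real_normK ?num_real// lerD2r lerDl.
by rewrite mulrn_wge0// mulr_ge0.
Qed.

Lemma normC_sum (I : Type) (s : seq I) (P : pred I) (F : I -> R[i]) :
  normC (\sum_(i <- s | P i) F i) <= \sum_(i <- s | P i) normC (F i).
Proof.
elim/big_ind2 : _ => [|x1 x2 y1 y2 h1 h2|//]; first by rewrite Normc.normc0.
exact: (le_trans (normCD _ _) (lerD h1 h2)).
Qed.

Lemma normC_lt z x : (`|z| < x%:C) = (normC z < x).
Proof. by rewrite normE ltcR. Qed.

Lemma normC_le z x : (`|z| <= x%:C) = (normC z <= x).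
Proof. by rewrite normE lecR. Qed.

Lemma normC_lt1 z : (`|z| < 1) = (normC z < 1).
Proof. by rewrite -(normC_lt z 1). Qed.

Lemma normC_eq1 z : `|z| = 1 <-> normC z = 1.
Proof. by rewrite normE; split => [/complexI|->]. Qed.

End modulus.

Section limits.
Variable R : realType.

Lemma cvgCP (T : Type) (F : set_system T) {FF : Filter F} (f : T -> R[i])
    (l : R[i]) :
  f @ F --> l <-> (fun x => normC (f x - l)) @ F --> (0 : R).
Proof.
split=> h.
- apply/cvgrPdist_lt => e e0.
  have e0' : 0 < e%:C by rewrite ltcR.
  move/cvgrPdist_lt : h => /(_ _ e0'); apply: filterS => x.
  by rewrite normC_lt sub0r normrN ger0_norm ?normC_ge0// normCBC.
- apply/cvgrPdist_lt => e e0.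
  (* In the partial order of [R[i]], a positive element is real. *)
  have [e' ee'] : exists e' : R, e = e'%:C.
    by exists (complex.Re e); rewrite RRe_real// gtr0_real.
  rewrite {e}ee' ltcR in e0 *.
  move/cvgrPdist_lt : h => /(_ _ e0); apply: filterS => x.
  by rewrite normC_lt sub0r normrN ger0_norm ?normC_ge0// normCBC.
Qed.

Lemma cvgC_le (T : Type) (F : set_system T) {FF : Filter F} (f : T -> R[i])
    (l : R[i]) (b : T -> R) :
  (forall x, normC (f x - l) <= b x) -> b @ F --> (0 : R) -> f @ F --> l.
Proof.
move=> fb b0; apply/cvgCP; apply: (squeeze_cvgr _ (@cvg_cst _ _ _ _ _) b0).
by apply: nearW => x; rewrite normC_ge0 fb.
Qed.

Lemma cvgC_ReIm (T : Type) (F : set_system T) {FF : Filter F} (f : T -> R[i])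
    (l : R[i]) : (fun x => complex.Re (f x)) @ F --> complex.Re l ->
  (fun x => complex.Im (f x)) @ F --> complex.Im l -> f @ F --> l.
Proof.
move=> hr hi; apply: (@cvgC_le _ _ _ _ _
  (fun x => `|complex.Re (f x) - complex.Re l| + `|complex.Im (f x) - complex.Im l|)).
  by move=> x; apply: le_trans (normC_leReIm _) _; rewrite !raddfB.
rewrite -[X in _ --> X](addr0 (0 : R)); apply: cvgD; apply/norm_cvg0P.
  by rewrite -(subrr (complex.Re l)); apply: cvgB => //; exact: cvg_cst.
by rewrite -(subrr (complex.Im l)); apply: cvgB => //; exact: cvg_cst.
Qed.

Lemma cvgC_norm (T : Type) (F : set_system T) {FF : Filter F} (f : T -> R[i])
    (l : R[i]) : f @ F --> l -> (fun x => normC (f x)) @ F --> normC l.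
Proof.
move=> /cvgCP h; apply/cvgrPdistC_lt => e e0.
move/cvgrPdistC_lt : h => /(_ _ e0); apply: filterS => x.
rewrite subr0 ger0_norm ?normC_ge0//; apply: le_lt_trans.
rewrite ler_norml; apply/andP; split.
  have := normCB (f x) (f x - l).
  by rewrite (_ : f x - (f x - l) = l); [lra|ring].
have := normCD l (f x - l).
by rewrite (_ : l + (f x - l) = f x); [lra|ring].
Qed.

Lemma Re_sum (I : Type) (s : seq I) (P : pred I) (F : I -> R[i]) :
  complex.Re (\sum_(i <- s | P i) F i) = \sum_(i <- s | P i) complex.Re (F i).
Proof. exact: (raddf_sum (@complex.Re R)). Qed.

Lemma Im_sum (I : Type) (s : seq I) (P : pred I) (F : I -> R[i]) :
  complex.Im (\sum_(i <- s | P i) F i) = \sum_(i <- s | P i) complex.Im (F i).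
Proof. exact: (raddf_sum (@complex.Im R)). Qed.

Lemma cvg_sumr (K : numFieldType) (V : normedModType K) (T I : Type)
    (F : set_system T) {FF : Filter F} (s : seq I) (P : pred I)
    (f : I -> T -> V) (l : I -> V) :
  (forall i, P i -> f i @ F --> l i) ->
  (fun x => \sum_(i <- s | P i) f i x) @ F --> \sum_(i <- s | P i) l i.
Proof. by move=> h; apply: cvg_big => //; exact: add_continuous. Qed.

Lemma cvg_nneg_series (b : nat -> R) (B : R) : (forall k, 0 <= b k) ->
  (forall n, \sum_(0 <= k < n) b k <= B) -> cvgn (series b).
Proof.
move=> b0 bB; apply: nondecreasing_is_cvgn.
  exact: nondecreasing_series.
by exists B => _ [n _ <-]; exact: bB.
Qed.

Lemma nneg_series_le (b : nat -> R) (B : R) n : (forall k, 0 <= b k) ->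
  series b @ \oo --> B -> \sum_(0 <= k < n) b k <= B.
Proof.
move=> b0 bB; rewrite -(cvg_lim _ bB)//.
apply: (@nondecreasing_cvgn_le _ (series b)); first exact: nondecreasing_series.
by apply/cvg_ex; exists B.
Qed.

Lemma cvgn_le_bound (u : nat -> R) (l B : R) :
  u @ \oo --> l -> (forall n, u n <= B) -> l <= B.
Proof.
move=> ul uB; rewrite -(cvg_lim _ ul)//; apply: limr_le; first by apply/cvg_ex; exists l.
exact: nearW.
Qed.

(** Real and imaginary parts converge by comparison. The explicit tail bound depends on [b] only,
    which gives the uniformity needed in [tannery]; at [n = 0] it bounds the sum itself. *)
Lemma cvgC_series_dominated (a : nat -> R[i]) (b : nat -> R) :
  (forall k, normC (a k) <= b k) -> cvgn (series b) ->
  exists2 l, series a @ \oo --> l &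
    forall n, normC (l - \sum_(0 <= k < n) a k) <=
              limn (series b) - \sum_(0 <= k < n) b k.
Proof.
move=> ab cb.
have b0 k : 0 <= b k by exact: le_trans (normC_ge0 _) (ab k).
have hre : cvgn (series (fun k => complex.Re (a k))).
  apply: normed_cvg; apply: series_le_cvg cb => [k|//|k] /=; first by [].
  exact: le_trans (normRe_le _) (ab k).
have him : cvgn (series (fun k => complex.Im (a k))).
  apply: normed_cvg; apply: series_le_cvg cb => [k|//|k] /=; first by [].
  exact: le_trans (normIm_le _) (ab k).
exists (limn (series (fun k => complex.Re (a k))) +i* limn (series (fun k => complex.Im (a k)))).
  apply: cvgC_ReIm => /=; rewrite /series /=.
    by under eq_fun do rewrite Re_sum; exact: hre.
  by under eq_fun do rewrite Im_sum; exact: him.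
set l := _ +i* _ => n.
have al : series a @ \oo --> l.
  apply: cvgC_ReIm => /=; rewrite /series /=.
    by under eq_fun do rewrite Re_sum; exact: hre.
  by under eq_fun do rewrite Im_sum; exact: him.
have h : (fun m => normC (series a m - \sum_(0 <= k < n) a k)) @ \oo -->
   normC (l - \sum_(0 <= k < n) a k).
  by apply: cvgC_norm; apply: cvgB; [exact: al|exact: cvg_cst].
rewrite -(cvg_lim _ h)//; apply: limr_le; first by apply/cvg_ex; eexists; exact: h.
near=> m; have nm : (n <= m)%N by near: m; exact: nbhs_infty_ge.
rewrite /series /= (@big_cat_nat _ _ _ n 0 m)//= addrAC subrr add0r.
apply: le_trans (normC_sum _ _ _) _.
rewrite lerBrDl; apply: (@le_trans _ _ (\sum_(0 <= k < m) b k)).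
  by rewrite (@big_cat_nat _ _ _ n 0 m)//= lerD2l ler_sum.
exact: (nneg_series_le _ b0 cb).
Unshelve. all: by end_near. Qed.

(** Dominated convergence for series: the majorant makes the tails beyond some [K] small uniformly
    in [m], and the finitely many terms before [K] converge one by one. *)
Lemma tannery (x : nat -> nat -> R[i]) (y X : nat -> R[i]) (b : nat -> R) :
  (forall m k, normC (x m k) <= b k) -> cvgn (series b) ->
  (forall k, x ^~ k @ \oo --> y k) ->
  (forall m, series (x m) @ \oo --> X m) ->
  exists2 Y : R[i], series y @ \oo --> Y & X @ \oo --> Y.
Proof.
move=> xb cb xy xX.
have yb k : normC (y k) <= b k.
  by apply: (cvgn_le_bound (cvgC_norm (xy k))) => m; exact: xb.
have [Y yY tY] := cvgC_series_dominated yb cb.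
exists Y => //; apply/cvgCP/cvgrPdistC_lt => e e0.
have e4 : 0 < e / 4 by rewrite divr_gt0.
have [K hK] : exists K, limn (series b) - \sum_(0 <= k < K) b k < e / 4.
  have /cvgrPdist_lt/(_ _ e4) [K _ hK] : series b @ \oo --> limn (series b) by [].
  by exists K; apply: le_lt_trans (hK K _) => /=; rewrite ?ler_norm.
have : (fun m => normC (\sum_(0 <= k < K) x m k - \sum_(0 <= k < K) y k)) @ \oo --> (0:R).
  by apply/cvgCP; apply: cvg_sumr => i _; exact: xy.
move=> /cvgrPdistC_lt /(_ _ e4); apply: filterS => m.
rewrite !subr0 !ger0_norm ?normC_ge0// => hm.
have [X' xX' tX] := cvgC_series_dominated (xb m) cb.
have XX' : X m = X' by exact: cvg_unique (xX m) xX'.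
have -> : X m - Y = (X m - \sum_(0 <= k < K) x m k) +
  (\sum_(0 <= k < K) x m k - \sum_(0 <= k < K) y k) -
  (Y - \sum_(0 <= k < K) y k) by ring.
apply: le_lt_trans (normCB _ _) _; apply: le_lt_trans (lerD (normCD _ _) (lexx _)) _.
by have := tX K; have := tY K; rewrite XX'; lra.
Qed.

End limits.

(** * Parseval's identity on the circle *)

Section circle_mean.
Variable R : realType.
Local Notation mu := (@lebesgue_measure R).

Lemma ae_imp (P Q : R -> Prop) : (forall x, P x -> Q x) ->
  {ae mu, forall x, P x} -> {ae mu, forall x, Q x}.
Proof. exact: (@filterS _ _ (ae_filter_ringOfSetsType mu)). Qed.

Lemma ae_and (P Q : R -> Prop) : {ae mu, forall x, P x} ->
  {ae mu, forall x, Q x} -> {ae mu, forall x, P x /\ Q x}.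
Proof. exact: (@filterI _ _ (ae_filter_ringOfSetsType mu)). Qed.

Definition cis (t : R) : R[i] := cos t +i* sin t.

Definition angles : set R := `[0, 2 * pi]%classic.

Lemma cisX t k : cis t ^+ k = cis (k%:R * t).
Proof.
elim: k => [|k ih]; first by rewrite expr0 mul0r /cis cos0 sin0.
rewrite exprS ih /cis -[k.+1]add1n natrD mulrDl mul1r cosD sinD.
by apply/eqP; rewrite eq_complex /=; apply/andP; split; apply/eqP; ring.
Qed.

Lemma norm_cis t : normC (cis t) = 1.
Proof. by rewrite /= cos2Dsin2 sqrtr1. Qed.

Lemma mu_angles : mu angles = (2 * pi)%:E.
Proof.
rewrite /angles lebesgue_measure_itv /= lte_fin mulr_gt0 ?pi_gt0// -EFinB.
by rewrite subr0.
Qed.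

Lemma measurable_angles : measurable angles.
Proof. exact: measurable_itv. Qed.

Lemma Rintegral_cst_angles (c : R) : \int[mu]_(t in angles) c = c * (2 * pi).
Proof.
rewrite Rintegral_cst; last exact: measurable_angles.
by congr (_ * _); exact: (congr1 fine mu_angles).
Qed.

Lemma integrable_angles (f : R -> R) : continuous f ->
  mu.-integrable angles (EFin \o f).
Proof.
move=> cf; apply: continuous_compact_integrable; first exact: segment_compact.
exact: continuous_subspaceT.
Qed.

Lemma Rintegral_dominated (f_ : nat -> R -> R) (f : R -> R) (M : R) :
  (forall n, measurable_fun angles (f_ n)) -> measurable_fun angles f ->
  (forall n t, angles t -> `|f_ n t| <= M) ->
  {ae mu, forall t, angles t -> f_ ^~ t @ \oo --> f t} ->
  (fun n => \int[mu]_(t in angles) f_ n t) @ \oo --> \int[mu]_(t in angles) f t.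
Proof.
move=> mf_ mf fM ff.
have iM : mu.-integrable angles (EFin \o cst M).
  by apply: integrable_angles => x; exact: cvg_cst.
have [|||||iF _ cF] := @dominated_convergence _ _ R mu _ measurable_angles
  (fun n => EFin \o f_ n) (EFin \o f) (EFin \o cst M).
- by move=> n; apply/measurable_EFinP; exact: mf_.
- exact/measurable_EFinP.
- apply: ae_imp ff => t h /h ht /=.
  by apply: cvg_EFin => //; apply: nearW.
- by [].
- by apply: aeW => t n At /=; rewrite lee_fin fM.
have fin : (\int[mu]_(t in angles) (EFin \o f) t)%E \is a fin_num.
  by apply: integrable_fin_num; [exact: measurable_angles|exact: iF].
apply: fine_cvg; rewrite fineK//; exact: cF.
Qed.

Lemma continuous_Re_cis (c : R[i]) (m : nat) :
  continuous (fun t => complex.Re (c * cis t ^+ m)).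
Proof.
have -> : (fun t => complex.Re (c * cis t ^+ m)) =
    (fun t => complex.Re c * cos (m%:R * t) - complex.Im c * sin (m%:R * t)).
  by apply/funext => t; rewrite cisX; case: c.
have cm : continuous (fun t : R => m%:R * t) by exact: mulrl_continuous.
have cc : continuous (fun t : R => cos (m%:R * t)).
  by move=> t; exact: (continuous_comp (cm t) (@continuous_cos R _)).
have cs : continuous (fun t : R => sin (m%:R * t)).
  by move=> t; exact: (continuous_comp (cm t) (@continuous_sin R _)).
by move=> t; apply: cvgB; apply: cvgM; [exact: cvg_cst|exact: cc|exact: cvg_cst|exact: cs].
Qed.

Lemma continuous_Im_cis (c : R[i]) (m : nat) :
  continuous (fun t => complex.Im (c * cis t ^+ m)).
Proof.
have -> : (fun t => complex.Im (c * cis t ^+ m)) =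
    (fun t => complex.Re (- 'i * c * cis t ^+ m)).
  by apply/funext => t; case: c => a b; case: (cis t ^+ m) => x y /=; ring.
exact: continuous_Re_cis.
Qed.

Lemma Rintegral_Re_cis (c : R[i]) (m : nat) : (0 < m)%N ->
  \int[mu]_(t in angles) complex.Re (c * cis t ^+ m) = 0.
Proof.
move=> m0.
(* An antiderivative with period 2 pi, because [m] is a nonzero integer. *)
pose F t := (m%:R)^-1 * (complex.Re c * sin (m%:R * t) + complex.Im c * cos (m%:R * t)).
have dF (x : R) : is_derive x 1 F (complex.Re (c * cis x ^+ m)).
  apply: is_derive_eq.
  rewrite cisX; case: c @F => a b F /=.
  rewrite /GRing.scale/=.
  have mn0 : (m%:R : R) != 0 by rewrite pnatr_eq0 -lt0n.
  by field.
have cF : continuous F.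
  by move=> x; apply/differentiable_continuous/derivable1_diffP; case: (dF x).
rewrite /Rintegral (@continuous_FTC2 _ _ F).
- rewrite -EFinB /= /F mulr0 sin0 cos0.
  have -> : m%:R * (2 * pi) = 0 + (pi *+ 2) *+ m :> R.
    by rewrite add0r -[in RHS]mulr_natl -[pi *+ 2]mulr_natl.
  by rewrite (periodicn (@cosD2pi R)) (periodicn (@sinD2pi R)) sin0 cos0 subrr.
- by rewrite mulr_gt0 ?pi_gt0.
- exact/continuous_subspaceT/continuous_Re_cis.
- split.
  + by move=> x _; case: (dF x).
  + by apply: cvg_at_right_filter; exact: cF.
  + by apply: cvg_at_left_filter; exact: cF.
- by move=> x _; rewrite derive1E; case: (dF x).
Qed.

Lemma continuous_sum (I : Type) (s : seq I) (P : pred I) (F : I -> R -> R) :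
  (forall i, P i -> continuous (F i)) ->
  continuous (fun t => \sum_(i <- s | P i) F i t).
Proof. by move=> h t; apply: cvg_sumr => i Pi; exact: h. Qed.

Lemma continuous_sqr_normC_poly (b : nat -> R[i]) n :
  continuous (fun t => normC (\sum_(0 <= k < n) b k * cis t ^+ k) ^+ 2).
Proof.
under eq_fun do rewrite sqr_normCE Re_sum Im_sum !expr2.
have cr : continuous (fun t => \sum_(0 <= k < n) complex.Re (b k * cis t ^+ k)).
  by apply: continuous_sum => k _; exact: continuous_Re_cis.
have ci : continuous (fun t => \sum_(0 <= k < n) complex.Im (b k * cis t ^+ k)).
  by apply: continuous_sum => k _; exact: continuous_Im_cis.
by move=> t; apply: cvgD; apply: cvgM; [exact: cr|exact: cr|exact: ci|exact: ci].
Qed.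

Lemma sqr_normCD (z w : R[i]) : normC (z + w) ^+ 2 =
  normC z ^+ 2 + normC w ^+ 2 + 2 * complex.Re (z * w^*%C).
Proof. by rewrite !sqr_normCE; case: z => a b; case: w => c d /=; ring. Qed.

Lemma conj_cis t k : (cis t ^+ k)^*%C = (cis t)^*%C ^+ k.
Proof. by rewrite rmorphXn. Qed.

Lemma cisJ t : cis t * (cis t)^*%C = 1.
Proof. by rewrite -normC_sqrJ norm_cis expr1n. Qed.

Lemma ReJ (z : R[i]) : complex.Re z^*%C = complex.Re z.
Proof. by case: z. Qed.

(** Induction on the number of terms avoids a double sum: the new term of index [n] meets the older
    ones in real parts of products which, after conjugation, have frequency [n - i > 0] and mean
    zero. *)
Lemma parseval_poly (b : nat -> R[i]) n :
  \int[mu]_(t in angles) normC (\sum_(0 <= k < n) b k * cis t ^+ k) ^+ 2 =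
  2 * pi * \sum_(0 <= k < n) normC (b k) ^+ 2.
Proof.
elim: n => [|n ih].
  under eq_Rintegral do rewrite big_geq// Normc.normc0 expr0n/=.
  by rewrite Rintegral_cst_angles big_geq ?mulr0 ?mul0r.
under eq_Rintegral => t _.
  rewrite big_nat_recr//= sqr_normCD Normc.normcM normCX norm_cis expr1n mulr1.
  rewrite mulr_suml Re_sum.
  rewrite (_ : \sum_(0 <= i < n) _ = \sum_(0 <= i < n)
      complex.Re ((b i)^*%C * b n * cis t ^+ (n - i))); last first.
    apply: eq_big_nat => i /andP[_ lin].
    rewrite -ReJ rmorphM/= conjcK rmorphM/= conj_cis.
    rewrite -[in cis t ^+ n](subnKC (ltnW lin)) exprD.
    congr complex.Re.
    rewrite [LHS](_ : _ = (b i)^*%C * b n * cis t ^+ (n - i) * (cis t * (cis t)^*%C) ^+ i).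
      by rewrite cisJ expr1n mulr1.
    by rewrite exprMn; ring.
  over.
rewrite big_nat_recr//= mulrDr -ih.
have c1 : continuous (fun t => \sum_(0 <= i < n) complex.Re ((b i)^*%C * b n * cis t ^+ (n - i))).
  by apply: continuous_sum => i _; exact: continuous_Re_cis.
rewrite RintegralD; last 3 first.
- exact: measurable_angles.
- apply: integrable_angles => t; apply: cvgD; last exact: cvg_cst.
  exact: continuous_sqr_normC_poly.
- apply: integrable_angles => t; apply: cvgM; first exact: cvg_cst.
  exact: c1.
rewrite RintegralD; last 3 first.
- exact: measurable_angles.
- apply: integrable_angles; exact: continuous_sqr_normC_poly.
- by apply: integrable_angles => t; exact: cvg_cst.
rewrite Rintegral_cst_angles RintegralZl; last 2 first.
- exact: measurable_angles.
- exact: integrable_angles.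
rewrite -[RHS]addr0; congr (_ + _); first by rewrite mulrC.
suff -> : \int[mu]_(t in angles) (\sum_(0 <= i < n) complex.Re ((b i)^*%C * b n * cis t ^+ (n - i))) = 0
  by rewrite mulr0.
(* The number [m] of summands is separated from the frequency [n], which must stay fixed during the
   induction. *)
have H m : (m <= n)%N -> \int[mu]_(t in angles) (\sum_(0 <= i < m) complex.Re ((b i)^*%C * b n * cis t ^+ (n - i))) = 0.
  elim: m => [|m ihm] lmn.
    under eq_Rintegral do rewrite big_geq//.
    by rewrite Rintegral_cst_angles mul0r.
  under eq_Rintegral do rewrite big_nat_recr//=.
  rewrite RintegralD; last 3 first.
  - exact: measurable_angles.
  - apply: integrable_angles; apply: continuous_sum => i _.
    exact: continuous_Re_cis.
  - apply: integrable_angles; exact: continuous_Re_cis.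
  by rewrite ihm ?(ltnW lmn)// Rintegral_Re_cis ?addr0// subn_gt0.
exact: H.
Qed.

End circle_mean.

(** * Power series, Parseval's identity on the closed disc, Cauchy's estimate *)

Section power_series.
Variable R : realType.
Local Notation mu := (@lebesgue_measure R).
Implicit Types (a b : nat -> R[i]) (z w : R[i]) (r s : R).

Definition ps a z : R[i] := limn (series (fun k => a k * z ^+ k)).

Definition absconv a r := cvgn (series (fun k => normC (a k) * r ^+ k)).

Lemma cvgn_boundedR (u : nat -> R) (l : R) : u @ \oo --> l ->
  exists B, forall n, `|u n| <= B.
Proof.
move=> ul; have : bounded_fun u by apply: cvg_seq_bounded; apply/cvg_ex; exists l.
by move=> /pinfty_ex_gt0[B _ h]; exists B => n; exact: h.
Qed.

(** Abel's lemma: comparison with the geometric series of ratio [s / r]. *)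
Lemma absconv_bounded a B r s : (forall k, normC (a k) * r ^+ k <= B) ->
  0 <= s < r -> absconv a s.
Proof.
move=> h /andP[s0 sr]; have r0 : 0 < r by exact: le_lt_trans sr.
have B0 : 0 <= B by apply: le_trans (h 0%N); rewrite mulr_ge0 ?normC_ge0 ?exprn_ge0// ltW.
apply: (@series_le_cvg _ _ (geometric B (s / r))) => [k|k|k|].
- by rewrite mulr_ge0 ?normC_ge0 ?exprn_ge0.
- by rewrite /geometric/= mulr_ge0 ?exprn_ge0// divr_ge0// ltW.
- rewrite /geometric/= expr_div_n mulrA ler_pdivlMr ?exprn_gt0//.
  by rewrite mulrAC ler_wpM2r ?exprn_ge0.
- apply: is_cvg_geometric_series.
  by rewrite ger0_norm ?divr_ge0 ?(ltW r0)// ltr_pdivrMr// mul1r.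
Qed.

(** Each term is a difference of two consecutive partial sums, which are bounded, so Abel's lemma
    applies. *)
Lemma cvg_absconv a z (l : R[i]) s : series (fun k => a k * z ^+ k) @ \oo --> l ->
  0 <= s < normC z -> absconv a s.
Proof.
move=> /cvgC_norm /cvgn_boundedR[B hB]; apply: (@absconv_bounded _ (B + B)) => k.
rewrite -normCX -Normc.normcM.
have -> : a k * z ^+ k = series (fun k => a k * z ^+ k) k.+1 -
  series (fun k => a k * z ^+ k) k by rewrite /series/= big_nat_recr//= addrAC subrr add0r.
apply: le_trans (normCB _ _) _.
by apply: lerD; [have := hB k.+1|have := hB k]; rewrite ger0_norm ?normC_ge0.
Qed.

Lemma ps_cvg a z r : absconv a r -> normC z <= r ->
  series (fun k => a k * z ^+ k) @ \oo --> ps a z.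
Proof.
move=> ca zr.
have [|l al _] := @cvgC_series_dominated R (fun k => a k * z ^+ k)
   (fun k => normC (a k) * r ^+ k) _ ca.
  move=> k; rewrite Normc.normcM normCX ler_wpM2l ?normC_ge0//.
  by rewrite lerXn2r// nnegrE ?normC_ge0//; exact: le_trans (normC_ge0 _) zr.
by rewrite /ps (cvg_lim _ al).
Qed.

Lemma psE a z (l : R[i]) : series (fun k => a k * z ^+ k) @ \oo --> l -> ps a z = l.
Proof. by move=> h; exact: cvg_lim. Qed.

Lemma absconv1_cis b t : absconv b 1 ->
  series (fun k => b k * cis t ^+ k) @ \oo --> ps b (cis t).
Proof. by move=> cb; apply: (ps_cvg cb); rewrite norm_cis. Qed.

Lemma norm_partial_le b (B : R) n z : (forall n, \sum_(0 <= k < n) normC (b k) <= B) ->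
  normC z <= 1 -> normC (\sum_(0 <= k < n) b k * z ^+ k) <= B.
Proof.
move=> hB z1; apply: le_trans (normC_sum _ _ _) _; apply: le_trans (hB n).
apply: ler_sum => k _; rewrite Normc.normcM normCX ler_piMr ?normC_ge0//.
by rewrite exprn_ile1// normC_ge0.
Qed.

Lemma absconv1 b : absconv b 1 <-> cvgn (series (fun k => normC (b k))).
Proof. by rewrite /absconv; under eq_fun do rewrite expr1n mulr1. Qed.

Lemma measurable_sqr_ps_cis b : absconv b 1 ->
  measurable_fun (@angles R) (fun t => normC (ps b (cis t)) ^+ 2).
Proof.
move=> cb; apply: (@measurable_fun_cvg _ _ _ _
  (fun n t => normC (\sum_(0 <= k < n) b k * cis t ^+ k) ^+ 2)).
  move=> n; apply: measurable_funTS; apply: continuous_measurable_fun.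
  exact: continuous_sqr_normC_poly.
move=> t _; under eq_fun do rewrite expr2.
by rewrite expr2; apply: cvgM; apply: cvgC_norm; exact: absconv1_cis.
Qed.

(** Limit of [parseval_poly] along the partial sums, all bounded on the circle by the sum [B] of the
    moduli of the coefficients. *)
Lemma parseval b : absconv b 1 ->
  cvgn (series (fun k => normC (b k) ^+ 2)) /\
  \int[mu]_(t in @angles R) normC (ps b (cis t)) ^+ 2 =
  2 * pi * limn (series (fun k => normC (b k) ^+ 2)).
Proof.
move=> cb; have /absconv1 cb1 := cb.
set B := limn (series (fun k => normC (b k))).
have hB n : \sum_(0 <= k < n) normC (b k) <= B.
  by apply: nneg_series_le cb1 => k; exact: normC_ge0.
have B0 : 0 <= B by apply: le_trans (hB 0%N); rewrite big_geq.
have bB k : normC (b k) <= B.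
  apply: le_trans (hB k.+1); rewrite big_nat_recr//= lerDr.
  by apply: sumr_ge0 => i _; exact: normC_ge0.
have c2 : cvgn (series (fun k => normC (b k) ^+ 2)).
  apply: (@series_le_cvg _ _ (B *: (fun k => normC (b k)))) => [k|k|k|].
  - by rewrite exprn_ge0 ?normC_ge0.
  - by rewrite /= mulr_ge0 ?normC_ge0.
  - by rewrite /= expr2 ler_wpM2r ?normC_ge0.
  - exact: is_cvg_seriesZ.
split=> //.
have h1 : (fun n => \int[mu]_(t in @angles R)
    normC (\sum_(0 <= k < n) b k * cis t ^+ k) ^+ 2) @ \oo -->
    \int[mu]_(t in @angles R) normC (ps b (cis t)) ^+ 2.
  apply: (@Rintegral_dominated R (fun n t => normC (\sum_(0 <= k < n) b k * cis t ^+ k) ^+ 2)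
    (fun t => normC (ps b (cis t)) ^+ 2) (B ^+ 2)).
  - move=> n; apply: measurable_funTS; apply: continuous_measurable_fun.
    exact: continuous_sqr_normC_poly.
  - exact: measurable_sqr_ps_cis.
  - move=> n t _; rewrite ger0_norm ?exprn_ge0 ?normC_ge0//.
    rewrite lerXn2r// ?nnegrE ?normC_ge0//.
    by apply: norm_partial_le => //; rewrite norm_cis.
  - apply: aeW => t _; under eq_fun do rewrite expr2.
    by rewrite expr2; apply: cvgM; apply: cvgC_norm; exact: absconv1_cis.
have h2 : (fun n => \int[mu]_(t in @angles R)
    normC (\sum_(0 <= k < n) b k * cis t ^+ k) ^+ 2) @ \oo -->
    2 * pi * limn (series (fun k => normC (b k) ^+ 2)).
  under eq_fun do rewrite parseval_poly.
  by apply: cvgM; [exact: cvg_cst|exact: c2].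
exact: (cvg_unique _ h1 h2).
Qed.

(** Coefficients of the dilation f(r z), which moves the circle of radius [r] to the unit circle,
    where Parseval's identity is available. *)
Definition dil r a k := a k * r%:C ^+ k.

Lemma normC_dil r a k : 0 <= r -> normC (dil r a k) = normC (a k) * r ^+ k.
Proof. by move=> r0; rewrite Normc.normcM normCX normC_real ger0_norm. Qed.

Lemma absconv_dil a r : 0 <= r -> absconv a r -> absconv (dil r a) 1.
Proof.
by move=> r0 ca; apply/absconv1; under eq_fun do rewrite normC_dil//.
Qed.

Lemma ps_dil a r z : ps (dil r a) z = ps a (r%:C * z).
Proof. by rewrite /ps; under eq_fun do rewrite -mulrA -exprMn. Qed.

Lemma integrable_bounded (f : R -> R) (M : R) : measurable_fun (@angles R) f ->
  (forall t, `|f t| <= M) -> mu.-integrable (@angles R) (EFin \o f).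
Proof.
move=> mf fM; have iM : mu.-integrable (@angles R) (EFin \o cst M).
  by apply: integrable_angles => x; exact: cvg_cst.
refine (@le_integrable _ _ _ mu _ (@measurable_angles R) (EFin \o f) (EFin \o cst M) _ _ iM).
  exact/measurable_EFinP.
by move=> t _ /=; rewrite lee_fin (le_trans (fM t)) ?ler_norm.
Qed.

Lemma parseval_le b (M : R) : absconv b 1 ->
  (forall t, normC (ps b (cis t)) <= M) ->
  forall n, \sum_(0 <= k < n) normC (b k) ^+ 2 <= M ^+ 2.
Proof.
move=> cb hM n; have [c2 int2] := parseval cb.
apply: (@le_trans _ _ (limn (series (fun k => normC (b k) ^+ 2)))).
  by apply: nneg_series_le c2 => k; rewrite exprn_ge0 ?normC_ge0.
have pi2 : 0 < 2 * pi :> R by rewrite mulr_gt0 ?pi_gt0.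
rewrite -(ler_pM2l pi2) -int2 [leRHS]mulrC -Rintegral_cst_angles.
have le2 t : normC (ps b (cis t)) ^+ 2 <= M ^+ 2.
  rewrite lerXn2r// ?nnegrE ?normC_ge0//.
  exact: le_trans (normC_ge0 _) (hM t).
apply: le_Rintegral => //; first exact: measurable_angles.
- apply: (@integrable_bounded _ (M ^+ 2)); first exact: measurable_sqr_ps_cis.
  by move=> t; rewrite ger0_norm ?exprn_ge0 ?normC_ge0.
- by apply: integrable_angles => x; exact: cvg_cst.
Qed.

(** Parseval replaces Cauchy's integral formula: the square of a single coefficient of the dilation
    is at most the sum of all squares, hence at most [M ^+ 2]. *)
Lemma cauchy_estimate a (M r : R) : 0 <= r -> absconv a r ->
  (forall t, normC (ps a (r%:C * cis t)) <= M) ->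
  forall n, normC (a n) * r ^+ n <= M.
Proof.
move=> r0 ca hM n.
have M0 : 0 <= M by exact: le_trans (normC_ge0 _) (hM 0).
rewrite -normC_dil// -(ler_pXn2r (isT : (0 < 2)%N)) ?nnegrE ?normC_ge0//.
have h t : normC (ps (dil r a) (cis t)) <= M by rewrite ps_dil.
apply: le_trans (parseval_le (absconv_dil r0 ca) h n.+1).
rewrite big_nat_recr//= lerDr; apply: sumr_ge0 => i _.
by rewrite exprn_ge0 ?normC_ge0.
Qed.

(** Cauchy's estimate with bound 0 for the difference. It is applied at [r / 2] because mere
    convergence at radius [r] gives absolute convergence only at smaller radii. *)
Lemma ps_coef_unique a b r : 0 < r -> absconv a r -> absconv b r ->
  (forall z, normC z <= r -> ps a z = ps b z) -> a = b.
Proof.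
move=> r0 ca cb h; apply/funext => n; apply/eqP; rewrite -subr_eq0 -normC_eq0.
have dab z : normC z <= r ->
    series (fun k => (a k - b k) * z ^+ k) @ \oo --> (0 : R[i]).
  move=> zr; rewrite -(subrr (ps a z)) {2}h//.
  rewrite [X in X @ _ --> _](_ : _ = series (fun k => a k * z ^+ k) -
    series (fun k => b k * z ^+ k)); last first.
    apply/funext => m; rewrite /series !fctE/= -sumrB.
    by apply: eq_bigr => i _; rewrite mulrBl.
  by apply: cvgB; apply: (@ps_cvg _ _ r).
have rz : normC r%:C = r by rewrite normC_real gtr0_norm.
have cd : absconv (fun k => a k - b k) (r / 2).
  apply: (cvg_absconv (dab r%:C _)); rewrite rz// divr_ge0 ?(ltW r0)//=.
  by rewrite ltr_pdivrMr// ltr_pMr// ltr1n.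
have r20 : 0 < r / 2 by rewrite divr_gt0.
rewrite eq_le normC_ge0 andbT -(pmulr_lle0 _ (exprn_gt0 n r20)).
apply: (cauchy_estimate (ltW r20) cd) => t.
rewrite (psE (dab _ _)) ?Normc.normc0// Normc.normcM norm_cis mulr1 normC_real.
by rewrite gtr0_norm// ler_pdivrMr// ler_pMr// ler1n.
Qed.

End power_series.

(** * Bounded analytic functions are global power series *)

Section recentering.
Variable R : realType.
Implicit Types (a b : nat -> R[i]) (z w v : R[i]) (r s : R).

(** [ps (dcoef a n)] is the [n]-th derivative of [ps a] divided by [n!], that is, the [n]-th
    coefficient of the expansion, as a function of its centre. *)
Definition dcoef a n (j : nat) : R[i] := 'C(j + n, n)%:R * a (j + n)%N.

Lemma binomial_term_le r s k n : 0 <= r -> 0 <= s -> (n <= k)%N ->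
  'C(k, n)%:R * (s ^+ (k - n) * r ^+ n) <= (s + r) ^+ k.
Proof.
move=> r0 s0 nk; rewrite exprDn (bigD1 (Ordinal (nk : (n < k.+1)%N)))//=.
rewrite mulr_natl lerDl; apply: sumr_ge0 => i _.
by rewrite mulrn_wge0// mulr_ge0// exprn_ge0.
Qed.

Lemma normC_natr (n : nat) : normC (n%:R : R[i]) = n%:R.
Proof. by rewrite -(rmorph_nat (real_complex R)) normC_real ger0_norm. Qed.

Lemma big_nat_shift (a : nat -> R[i]) z n N :
  \sum_(0 <= k < N) 'C(k, n)%:R * a k * z ^+ (k - n) =
  \sum_(0 <= j < N - n) dcoef a n j * z ^+ j.
Proof.
have [Nn|nN] := leqP N n.
  rewrite (_ : (N - n = 0)%N) ?[RHS]big_geq//; last by apply/eqP; rewrite subn_eq0.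
  rewrite big_nat_cond big1// => k /andP[/andP[_ kN] _].
  by rewrite bin_small ?(leq_trans kN)// !mul0r.
rewrite (@big_cat_nat _ _ _ n 0 N)//= ?(ltnW nN)//.
rewrite [X in X + _]big_nat_cond big1 ?add0r; last first.
  by move=> k /andP[/andP[_ kN] _]; rewrite bin_small// !mul0r.
rewrite -{1}(add0n n) big_addn; apply: eq_bigr => j _.
by rewrite /dcoef addnK.
Qed.

(** A single term of the binomial expansion of [(s + (r - s)) ^+ k] is at most [r ^+ k]. *)
Lemma sum_dcoef_le a r s n N : 0 <= s -> s < r -> absconv a r ->
  \sum_(0 <= k < N) 'C(k, n)%:R * normC (a k) * s ^+ (k - n) <=
  limn (series (fun k => normC (a k) * r ^+ k)) / (r - s) ^+ n.
Proof.
move=> s0 sr ca; have rs : 0 < r - s by rewrite subr_gt0.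
rewrite ler_pdivlMr ?exprn_gt0// mulr_suml.
apply: le_trans (nneg_series_le N _ ca); last first.
  by move=> k; rewrite mulr_ge0 ?normC_ge0 ?exprn_ge0// (le_trans s0) ?ltW.
apply: ler_sum => k _; have [kn|nk] := ltnP k n.
  by rewrite bin_small// !mul0r mulr_ge0 ?normC_ge0 ?exprn_ge0// (le_trans s0) ?ltW.
rewrite [leLHS](_ : _ = normC (a k) * ('C(k, n)%:R * (s ^+ (k - n) * (r - s) ^+ n))).
  2: by ring.
rewrite ler_wpM2l ?normC_ge0//.
rewrite (le_trans (binomial_term_le (ltW rs) s0 nk))//.
by rewrite addrC subrK.
Qed.

Lemma absconv_dcoef a r s n : 0 <= s -> s < r -> absconv a r ->
  absconv (dcoef a n) s.
Proof.
move=> s0 sr ca.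
apply: (@cvg_nneg_series _ _ (limn (series (fun k => normC (a k) * r ^+ k)) / (r - s) ^+ n)).
  by move=> k; rewrite mulr_ge0 ?normC_ge0 ?exprn_ge0.
move=> N; apply: le_trans (sum_dcoef_le n (N + n) s0 sr ca).
rewrite (@big_cat_nat _ _ _ n 0 (N + n))//= ?leq_addl//.
rewrite [leRHS](_ : _ = \sum_(0 <= k < n) 'C(k, n)%:R * normC (a k) * s ^+ (k - n) +
  \sum_(0 <= j < N) normC (dcoef a n j) * s ^+ j); last first.
  congr (_ + _); rewrite -{1}(add0n n) big_addn addnK; apply: eq_bigr => j _.
  by rewrite /dcoef Normc.normcM normC_natr addnK.
rewrite lerDr; apply: sumr_ge0 => k _.
by rewrite !mulr_ge0 ?normC_ge0 ?exprn_ge0.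
Qed.

Lemma cvgn_subn (T : topologicalType) (u : nat -> T) (l : T) n :
  u @ \oo --> l -> (fun N => u (N - n)%N) @ \oo --> l.
Proof.
move=> ul; have sub_oo : (subn^~ n) @ \oo --> \oo.
  move=> A [N _ hN]; exists (N + n)%N => // m /= Nm; apply: hN => /=.
  by rewrite leq_subRL ?(leq_trans _ Nm) ?leq_addl// addnC.
exact: (cvg_comp _ _ sub_oo ul).
Qed.

(** Only finite sums are rearranged: the polynomial of the first [N] terms is recentred by the
    binomial theorem, and [tannery] lets [N] grow. The majorant from [sum_dcoef_le] is geometric of
    ratio [normC v / (r - normC z)], which is below 1 by hypothesis. *)
Lemma recenter a r z v : absconv a r -> normC z + normC v < r ->
  series (fun n => ps (dcoef a n) z * v ^+ n) @ \oo --> ps a (z + v).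
Proof.
move=> ca zvr; have zr : normC z < r by rewrite (le_lt_trans _ zvr)// lerDl normC_ge0.
have z0 := normC_ge0 z; have v0 := normC_ge0 v.
have rz : 0 < r - normC z by rewrite subr_gt0.
set A := limn (series (fun k => normC (a k) * r ^+ k)).
pose x N n := (\sum_(0 <= k < N) 'C(k, n)%:R * a k * z ^+ (k - n)) * v ^+ n.
pose X N := \sum_(0 <= k < N) a k * (z + v) ^+ k.
have [|||N|Y yY XY] := @tannery R x (fun n => ps (dcoef a n) z * v ^+ n) X
   (geometric A (normC v / (r - normC z))).
- move=> N n; rewrite /x Normc.normcM normCX /geometric/= expr_div_n mulrA.
  rewrite [leRHS]mulrAC ler_wpM2r ?exprn_ge0//.
  apply: le_trans (sum_dcoef_le n N z0 zr ca).
  apply: le_trans (normC_sum _ _ _) _; apply: ler_sum => k _.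
  by rewrite !Normc.normcM normCX normC_natr.
- apply: is_cvg_geometric_series.
  rewrite ger0_norm ?divr_ge0 ?(ltW rz)// ltr_pdivrMr// mul1r.
  by rewrite ltrBrDl.
- move=> n; apply: cvgM; last exact: cvg_cst.
  under eq_fun do rewrite big_nat_shift.
  apply: (@cvgn_subn _ (fun N => \sum_(0 <= j < N) dcoef a n j * z ^+ j)).
  exact: (ps_cvg (absconv_dcoef (n := n) z0 zr ca) (lexx _)).
- apply: cvg_near_cst; exists N => // m /= Nm.
  rewrite /series/= /x /X.
  under eq_bigr do rewrite mulr_suml.
  rewrite exchange_big_nat/=. apply: eq_big_nat => k /andP[_ kN].
  rewrite exprDn (@big_cat_nat _ _ _ k.+1 0 m)//=; last exact: leq_trans Nm.
  rewrite [X in _ + X](_ : _ = 0) ?addr0; last first.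
    rewrite big_nat_cond big1// => i /andP[/andP[ki _] _].
    by rewrite bin_small// !mul0r.
  rewrite big_mkord mulr_sumr; apply: eq_bigr => i _.
  by rewrite -mulr_natl; ring.
have : X @ \oo --> ps a (z + v).
  by apply: (ps_cvg ca); apply: le_trans (normCD _ _) (ltW zvr).
by move=> /(cvg_unique _ XY) <-.
Qed.

End recentering.

(** * Local expansions and the enlargement of the disc of convergence *)

Section global_power_series.
Variable R : realType.
Implicit Types (F : R[i] -> R[i]) (a b : nat -> R[i]) (z w v : R[i]) (r s e : R).

Definition is_ps_at F w e a := forall v, normC v < e ->
  series (fun k => a k * v ^+ k) @ \oo --> F (w + v).

Lemma is_ps_at_le F w e e' a : e' <= e -> is_ps_at F w e a -> is_ps_at F w e' a.
Proof. by move=> ee h v ve; apply: h; exact: lt_le_trans ee. Qed.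

Lemma is_ps_at_absconv F w e a r : is_ps_at F w e a -> 0 <= r < e -> absconv a r.
Proof.
move=> h /andP[r0 re].
have n1 : normC ((r + e) / 2)%:C = (r + e) / 2.
  by rewrite normC_real ger0_norm// divr_ge0// addr_ge0// (le_trans r0)// ltW.
have [m1 m2] := midf_lt re.
by apply: (cvg_absconv (h ((r + e) / 2)%:C _)); rewrite n1// r0.
Qed.

Lemma is_ps_at_recenter F w e a u : is_ps_at F w e a -> normC u < e ->
  is_ps_at F (w + u) (e - normC u) (fun n => ps (dcoef a n) u).
Proof.
move=> h ue v; rewrite ltrBrDl => uv.
have uv0 : 0 <= normC u + normC v by rewrite addr_ge0 ?normC_ge0.
have [m1 m2] := midf_lt uv.
have ca : absconv a ((normC u + normC v + e) / 2).
  apply: (is_ps_at_absconv h); rewrite m2 andbT divr_ge0// addr_ge0//.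
  exact: le_trans (ltW uv).
have := recenter ca m1.
rewrite -addrA; set l := ps a _; suff -> : l = F (w + (u + v)) by [].
by apply: psE; apply: h; exact: le_lt_trans (normCD _ _) uv.
Qed.

Lemma is_ps_at_unique F w e e' a b : 0 < e -> 0 < e' -> is_ps_at F w e a ->
  is_ps_at F w e' b -> a = b.
Proof.
move=> e0 e0' ha hb; pose r := Num.min e e' / 2.
have m0 : 0 < Num.min e e' by rewrite lt_min e0.
have r0 : 0 < r by rewrite divr_gt0.
have rm : r < Num.min e e' by rewrite ltr_pdivrMr// ltr_pMr// ltr1n.
have re : r < e by rewrite (lt_le_trans rm)// ge_min lexx.
have re' : r < e' by rewrite (lt_le_trans rm)// ge_min lexx orbT.
apply: (ps_coef_unique r0).
- by apply: (is_ps_at_absconv ha); rewrite ltW.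
- by apply: (is_ps_at_absconv hb); rewrite ltW.
move=> z zr; rewrite (psE (ha z _)) ?(psE (hb z _))//; exact: le_lt_trans zr _.
Qed.

Lemma polar z : exists2 t, angles t & z = (normC z)%:C * cis t.
Proof.
have pi0 := pi_ge0 R.
have [->|z0] := eqVneq z 0.
  exists 0; last by rewrite Normc.normc0 mul0r.
  by rewrite /angles/= in_itv/= lexx mulr_ge0.
have N0 : 0 < normC z by rewrite lt_neqAle normC_ge0 eq_sym normC_eq0 z0.
have Nn := lt0r_neq0 N0.
pose x := complex.Re z / normC z; pose y := complex.Im z / normC z.
have xy : x ^+ 2 + y ^+ 2 = 1.
  by rewrite !expr_div_n -mulrDl -sqr_normCE divff// expf_neq0.
have x1 : -1 <= x <= 1.
  rewrite -ler_norml -(ler_pXn2r (isT : (0 < 2)%N)) ?nnegrE//.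
  by rewrite real_normK ?num_real// expr1n -xy lerDl sqr_ge0.
have zE t : cos t = x -> sin t = y -> z = (normC z)%:C * cis t.
  move=> ct st; rewrite /cis ct st; apply/eqP; rewrite eq_complex /=.
  rewrite !mul0r subr0 addr0 /x /y [_ * (_ / _)]mulrC [_ * (complex.Im _ / _)]mulrC.
  by rewrite !divfK// !eqxx.
have sy : sin (acos x) = `|y|.
  by rewrite sin_acos// -xy addrAC subrr add0r sqrtr_sqr.
have a0 := acos_ge0 x1; have api := acos_lepi x1.
have [y0|y0] := leP 0 y.
  exists (acos x); last by apply: zE; rewrite ?acosK ?sy ?ger0_norm.
  by rewrite /angles/= in_itv/= a0/=; lra.
exists (- acos x + pi *+ 2).
  by rewrite /angles/= in_itv/= -mulr_natl; lra.
apply: zE; first by rewrite cosD2pi cosN acosK.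
by rewrite sinD2pi sinN sy ltr0_norm// opprK.
Qed.

Lemma continuous_cis r t0 : (fun t => r%:C * cis t) @ t0 --> r%:C * cis t0.
Proof.
apply: cvgM; first exact: cvg_cst.
by apply: cvgC_ReIm => /=; [exact: continuous_cos|exact: continuous_sin].
Qed.

(** A Lebesgue number argument: an expansion of radius [e] at one point of the circle can be
    recentred, with radius at least [e / 2], at all points closer than [e / 2]; compactness of the
    interval of angles does the rest. *)
Lemma uniform_radius F r :
  (forall t, angles t -> exists2 e, 0 < e & exists a, is_ps_at F (r%:C * cis t) e a) ->
  exists2 e, 0 < e & forall t, angles t -> exists a, is_ps_at F (r%:C * cis t) e a.
Proof.
move=> h; have cA : compact (@angles R) by exact: segment_compact.
have /compact_near_coveringP := cA.
move=> /(_ R (0^'+) (fun e t => exists a, is_ps_at F (r%:C * cis t) e a)).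
move=> /(_ _)[].
  move=> t0 /h[e e0 [a ha]].
  have e20 : 0 < e / 2 by rewrite divr_gt0.
  near=> t e'.
  have te : normC (r%:C * cis t - r%:C * cis t0) < e / 2.
    near: t; have /cvgCP/cvgrPdistC_lt/(_ _ e20) := @continuous_cis r t0.
    by apply: filterS => t; rewrite subr0 ger0_norm ?normC_ge0.
  have := is_ps_at_recenter ha (lt_le_trans te _).
  rewrite ltW ?ltr_pdivrMr ?ltr_pMr ?ltr1n// => /(_ isT).
  rewrite addrC subrK => H; exists (fun n => ps (dcoef a n) (r%:C * cis t - r%:C * cis t0)).
  apply: is_ps_at_le H; rewrite lerBrDr.
  rewrite [leRHS](splitr e); apply: lerD; last exact: ltW.
  rewrite ltW//=; near: e'.
move=> d /= d0 hd; have d20 : 0 < d / 2 by rewrite divr_gt0.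
exists (d / 2) => // t At; apply: (hd (d / 2)) => //=.
by rewrite sub0r normrN gtr0_norm// ltr_pdivrMr// ltr_pMr// ltr1n.
Unshelve. all: by end_near. Qed.

(* Cauchy's estimate is used twice: for the expansions at the points of the
   circle of radius [r1 < rho], and for their [n]-th coefficients [dcoef a n],
   which are power series in the centre of the expansion. This bounds
   ['C(k, n) * |a k| * r1 ^+ (k - n) * r2 ^+ n] by [M] with [rho < r1 + r2];
   summing over [n] makes the radius of convergence larger than [rho]. *)
Lemma is_ps_at_extend F (M rho : R) a : 0 < rho < 1 -> (forall z, normC (F z) <= M) ->
  (forall z, normC z < 1 -> exists2 e, 0 < e & exists a, is_ps_at F z e a) ->
  is_ps_at F 0 rho a -> exists2 rho', rho < rho' <= 1 & is_ps_at F 0 rho' a.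
Proof.
move=> /andP[rho0 rho1] FM hloc ha.
have [d0 d0_gt0 hd0] : exists2 e, 0 < e & forall t, angles t ->
    exists a, is_ps_at F (rho%:C * cis t) e a.
  apply: uniform_radius => t _; apply: hloc.
  by rewrite Normc.normcM norm_cis mulr1 normC_real gtr0_norm.
(* The minimum with [rho] keeps the radius [r1] below positive. *)
pose d := Num.min d0 rho.
have d_gt0 : 0 < d by rewrite lt_min d0_gt0.
have drho : d <= rho by rewrite ge_min lexx orbT.
have hd t : angles t -> exists a, is_ps_at F (rho%:C * cis t) d a.
  by move=> /hd0[b hb]; exists b; apply: is_ps_at_le hb; rewrite ge_min lexx.
pose r1 := rho - d / 4.
have r10 : 0 < r1 by rewrite /r1; lra.
have nr1 t : normC (r1%:C * cis t) = r1.
  by rewrite Normc.normcM norm_cis mulr1 normC_real gtr0_norm.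
have hr1 t : angles t ->
    is_ps_at F (r1%:C * cis t) (d / 2) (fun n => ps (dcoef a n) (r1%:C * cis t)).
  move=> /hd[b hb].
  have h1 : normC (r1%:C * cis t) < rho by rewrite nr1 /r1; lra.
  have := is_ps_at_recenter ha h1; rewrite add0r nr1 => ha'.
  have E : r1%:C * cis t = rho%:C * cis t + (- (d / 4))%:C * cis t.
    by rewrite -mulrDl -rmorphD.
  have nd : normC ((- (d / 4))%:C * cis t) = d / 4.
    by rewrite Normc.normcM norm_cis mulr1 normC_real normrN gtr0_norm//; lra.
  have h2 : normC ((- (d / 4))%:C * cis t) < d by rewrite nd; lra.
  have := is_ps_at_recenter hb h2; rewrite -E nd => hb'.
  (* The expansion at [r1%:C * cis t] is obtained both from the one at 0, with radius [d / 4], and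
     from the one at the boundary point, with radius [3 d / 4]. By uniqueness the first inherits the
     larger radius and so reaches beyond the circle of radius [rho]. *)
  have -> := @is_ps_at_unique F (r1%:C * cis t) (rho - r1) (d - d / 4) _ _ _ _ ha' hb'.
  - by apply: is_ps_at_le hb'; lra.
  - by rewrite /r1; lra.
  - by lra.
have car1 n : absconv (dcoef a n) r1.
  apply: (@absconv_dcoef _ a ((r1 + rho) / 2)); rewrite ?(ltW r10)//.
    by rewrite /r1; lra.
  by apply: (is_ps_at_absconv ha); rewrite /r1; lra.
have nz t : exists2 t', angles t' & r1%:C * cis t = r1%:C * cis t'.
  by have [t' At' ->] := polar (r1%:C * cis t); exists t' => //; rewrite nr1.
(* Chosen so that [d / 4 < r3 < r2 < d / 2]: [r2] stays inside the discs of [hr1],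
   [r1 + r3 = rho + d / 16] exceeds [rho], and [r3 / r2 < 1] makes the sum over the binomial terms
   geometric. *)
pose r2 := 3 * d / 8; pose r3 := 5 * d / 16.
have r30 : 0 < r3 by rewrite /r3; lra.
have r20 : 0 < r2 by rewrite /r2; lra.
have r32 : r3 < r2 by rewrite /r3 /r2; lra.
have coefn n j : normC (dcoef a n j) * r1 ^+ j <= M / r2 ^+ n.
  apply: (cauchy_estimate (ltW r10) (car1 n)) => t.
  have [t' At' ->] := nz t.
  rewrite ler_pdivlMr ?exprn_gt0//.
  have := @cauchy_estimate R (fun n => ps (dcoef a n) (r1%:C * cis t')) M r2 (ltW r20).
  apply.
    by apply: (is_ps_at_absconv (hr1 _ At')); rewrite /r2; lra.
  move=> t2; rewrite (psE (hr1 _ At' _ _))//.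
  by rewrite Normc.normcM norm_cis mulr1 normC_real gtr0_norm// /r2; lra.
have M0 : 0 <= M by exact: le_trans (normC_ge0 _) (FM 0).
have q0 : 0 < r3 / r2 by rewrite divr_gt0.
have q1 : r3 / r2 < 1 by rewrite ltr_pdivrMr// mul1r.
have ge : cvgn (series (geometric 1 (r3 / r2))).
  by apply: is_cvg_geometric_series; rewrite gtr0_norm.
set G := limn (series (geometric 1 (r3 / r2))) in ge.
have cq : absconv a (rho + d / 32).
  apply: (@absconv_bounded _ _ (M * G) (r1 + r3)); last by rewrite /r1 /r3; lra.
  move=> k; rewrite exprDn mulr_sumr.
  apply: (@le_trans _ _ (\sum_(i < k.+1) M * (1 * (r3 / r2) ^+ i))); last first.
    rewrite -mulr_sumr ler_wpM2l// -(big_mkord xpredT (fun i => 1 * (r3 / r2) ^+ i)).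
    apply: (@nneg_series_le _ (geometric 1 (r3 / r2))) ge => i.
    by rewrite /geometric/= mulr_ge0// exprn_ge0// divr_ge0 ?ltW.
  apply: ler_sum => i _; have ik : (i <= k)%N by rewrite -ltnS.
  have := coefn i (k - i)%N; rewrite /dcoef subnK// Normc.normcM normC_natr => H.
  rewrite mul1r (expr_div_n r3 r2) [leRHS]mulrCA.
  rewrite [leLHS](_ : _ = r3 ^+ i * ('C(k, i)%:R * normC (a k) * r1 ^+ (k - i))).
  2: by rewrite -mulr_natl; move: (r1 ^+ (k - i)) (r3 ^+ i) => x y; ring.
  by rewrite ler_wpM2l// exprn_ge0// ltW.
exists (Num.min (rho + d / 32) 1).
  by rewrite lt_min ge_min lexx orbT rho1 andbT ltrDl; lra.
move=> z; rewrite lt_min => /andP[zq z1]; rewrite add0r.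
have [zr|zr] := ltP (normC z) rho; first by rewrite -[z in F z]add0r; exact: ha.
have [t At zE] := polar z.
(* Beyond [rho], [F] and [ps a] are compared through the expansion at the point of radius [r1] on
   the same ray: it sums to [ps a z] by absolute convergence and to [F z] by [hr1]. *)
pose v := (normC z - r1)%:C * cis t.
have zv : r1%:C * cis t + v = z by rewrite -mulrDl -rmorphD/= addrC subrK -zE.
have nv : normC v = normC z - r1.
  by rewrite Normc.normcM norm_cis mulr1 normC_real gtr0_norm// /r1; lra.
have h1 : series (fun n => ps (dcoef a n) (r1%:C * cis t) * v ^+ n) @ \oo --> ps a z.
  by rewrite -zv; apply: (recenter cq); rewrite nv nr1; lra.
have h2 : series (fun n => ps (dcoef a n) (r1%:C * cis t) * v ^+ n) @ \oo --> F z.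
  by rewrite -[in F z]zv; apply: (hr1 t At); rewrite nv /r1; lra.
have -> : F z = ps a z by exact: (cvg_unique _ h2 h1).
exact: (ps_cvg cq (ltW zq)).
Qed.

(** Let [sup S] be the largest radius up to 1 for which the expansion at 0 represents [F]. It is
    attained, since [is_ps_at] concerns open discs only, and [is_ps_at_extend] forbids it to be less
    than 1. *)
Lemma is_ps_at_global F (M : R) : (forall z, normC (F z) <= M) ->
  (forall z, normC z < 1 -> exists2 e, 0 < e & exists a, is_ps_at F z e a) ->
  exists a, is_ps_at F 0 1 a.
Proof.
move=> FM hloc.
have [|e0 e0_gt0 [a ha0]] := hloc 0; first by rewrite Normc.normc0.
pose S := [set e | 0 < e <= 1 /\ is_ps_at F 0 e a].
have Se : S (Num.min e0 1).
  split; first by rewrite lt_min e0_gt0 ge_min lexx orbT ltr01.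
  by apply: is_ps_at_le ha0; rewrite ge_min lexx.
have supS : has_sup S by split; [exists (Num.min e0 1)|exists 1 => e [/andP[]]].
have rho0 : 0 < sup S.
  have [/andP[m0 _] _] := Se; apply: lt_le_trans m0 _.
  exact: ub_le_sup supS.2 _ Se.
have rho1 : sup S <= 1 by apply: ge_sup; [exists (Num.min e0 1)|move=> e [/andP[]]].
have ha : is_ps_at F 0 (sup S) a.
  move=> v vS; have d0 : 0 < sup S - normC v by rewrite subr_gt0.
  have [e [_ he]] := sup_adherent d0 supS; rewrite opprB addrC subrK => ve.
  exact: he.
exists a; move: rho1; rewrite le_eqVlt => /predU1P[<-//|rho1].
have [|r /andP[rr r1] hr] := is_ps_at_extend _ FM hloc ha; first by rewrite rho0.
have Sr : S r by split=> //; rewrite r1 (lt_trans rho0 rr).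
by have := ub_le_sup supS.2 Sr; rewrite leNgt rr.
Qed.

End global_power_series.

(** * Square-summable sequences *)

Section square_summable.
Variable R : realType.
Implicit Types (a b d : nat -> R[i]) (c : R[i]) (t B : R).

Definition l2 a := cvgn (series (fun k => normC (a k) ^+ 2)).

Definition nsq a : R := limn (series (fun k => normC (a k) ^+ 2)).

Lemma l2_bounded a B : (forall n, \sum_(0 <= k < n) normC (a k) ^+ 2 <= B) ->
  l2 a /\ nsq a <= B.
Proof.
move=> h; have ca : l2 a.
  by apply: cvg_nneg_series h => k; rewrite exprn_ge0 ?normC_ge0.
by split=> //; exact: (cvgn_le_bound ca h).
Qed.

Lemma le_nsq a n : l2 a -> \sum_(0 <= k < n) normC (a k) ^+ 2 <= nsq a.
Proof. by apply: nneg_series_le => k; rewrite exprn_ge0 ?normC_ge0. Qed.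

Lemma nsq_ge0 a : l2 a -> 0 <= nsq a.
Proof. by move=> /(le_nsq 0); rewrite big_geq. Qed.

Lemma coef_le_nsq a k : l2 a -> normC (a k) ^+ 2 <= nsq a.
Proof.
move=> la; apply: le_trans (le_nsq k.+1 la); rewrite big_nat_recr//= lerDr.
by apply: sumr_ge0 => i _; rewrite exprn_ge0 ?normC_ge0.
Qed.

(** A crude substitute for the square root, enough where only boundedness matters. *)
Lemma le_of_sqr_le (x B : R) : 0 <= x -> x ^+ 2 <= B -> x <= 1 + B.
Proof. by move=> x0 xB; nra. Qed.

Lemma l2_coef_bounded a k : l2 a -> normC (a k) <= 1 + nsq a.
Proof. by move=> la; rewrite le_of_sqr_le ?normC_ge0// coef_le_nsq. Qed.

Lemma l2_absconv a s : l2 a -> 0 <= s < 1 -> absconv a s.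
Proof.
move=> la; apply: (@absconv_bounded _ _ (1 + nsq a)) => k.
by rewrite expr1n mulr1 l2_coef_bounded.
Qed.

Lemma nsq_eq0 a : l2 a -> nsq a <= 0 -> a = fun=> 0.
Proof.
move=> la a0; apply/funext => k; apply/eqP; rewrite -normC_eq0 -sqrf_eq0.
by rewrite eq_le exprn_ge0 ?normC_ge0// (le_trans (coef_le_nsq k la)).
Qed.

(* Convexity of the square; keeps constants explicit where Minkowski's
   inequality would bring in square roots. *)
Lemma sqr_normCD_le (x y : R[i]) t : 0 < t < 1 ->
  normC (x + y) ^+ 2 <= normC x ^+ 2 / (1 - t) + normC y ^+ 2 / t.
Proof.
move=> /andP[t0 t1]; have t1' : 0 < 1 - t by rewrite subr_gt0.
have := normCD x y; have := normC_ge0 (x + y).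
move: (normC x) (normC y) (normC (x + y)) => u v w w0 wuv.
apply: (@le_trans _ _ ((u + v) ^+ 2)).
  by rewrite lerXn2r// nnegrE// (le_trans w0).
rewrite -subr_ge0.
have -> : u ^+ 2 / (1 - t) + v ^+ 2 / t - (u + v) ^+ 2 =
  (t * u - (1 - t) * v) ^+ 2 / ((1 - t) * t).
  by field; rewrite !lt0r_neq0.
by rewrite divr_ge0 ?sqr_ge0// mulr_ge0// ltW.
Qed.

Lemma l2D a b t : 0 < t < 1 -> l2 a -> l2 b ->
  l2 (fun k => a k + b k) /\ nsq (fun k => a k + b k) <= nsq a / (1 - t) + nsq b / t.
Proof.
move=> tt la lb; have /andP[t0 t1] := tt; have t1' : 0 < 1 - t by rewrite subr_gt0.
apply: l2_bounded => n.
apply: (@le_trans _ _ (\sum_(0 <= k < n) (normC (a k) ^+ 2 / (1 - t) + normC (b k) ^+ 2 / t))).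
  by apply: ler_sum => k _; exact: sqr_normCD_le.
rewrite big_split/= -!mulr_suml lerD//.
  by rewrite ler_wpM2r ?invr_ge0 ?(ltW t1')// le_nsq.
by rewrite ler_wpM2r ?invr_ge0 ?(ltW t0)// le_nsq.
Qed.

Lemma l2Z c a : l2 a -> l2 (fun k => c * a k) /\
  nsq (fun k => c * a k) = normC c ^+ 2 * nsq a.
Proof.
move=> la.
have h : series (fun k => normC (c * a k) ^+ 2) @ \oo --> normC c ^+ 2 * nsq a.
  under eq_fun do rewrite Normc.normcM exprMn.
  rewrite (_ : series _ = (fun n => normC c ^+ 2 * series (fun k => normC (a k) ^+ 2) n)).
    by apply: cvgM; [exact: cvg_cst|exact: la].
  by apply/funext => n; rewrite /series/= mulr_sumr.
by split; [apply/cvg_ex; eexists; exact: h|exact: cvg_lim h].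
Qed.

Lemma l2_lin a b c : l2 a -> l2 b -> l2 (fun k => a k + c * b k).
Proof.
move=> la /(l2Z c)[lb _].
by apply: (@l2D a (fun k => c * b k) 2^-1 _ la lb).1; lra.
Qed.

Definition dot a b : R[i] := limn (series (fun k => a k * (b k)^*%C)).

(** The weighted inequality between arithmetic and geometric means stands in for Cauchy-Schwarz. The
    free weight [t] allows one norm to tend to 0 first and [t] afterwards, as in [adjoint]. *)
Lemma dot_cvg_le a b t : 0 < t -> l2 a -> l2 b ->
  series (fun k => a k * (b k)^*%C) @ \oo --> dot a b /\
  normC (dot a b) <= (t * nsq a + nsq b / t) / 2.
Proof.
move=> t0 la lb; pose e k := (t * normC (a k) ^+ 2 + normC (b k) ^+ 2 / t) / 2.
have ek k : normC (a k * (b k)^*%C) <= e k.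
  rewrite Normc.normcM normCJ /e; move: (normC (a k)) (normC (b k)) => u v.
  rewrite -subr_ge0.
  have -> : (t * u ^+ 2 + v ^+ 2 / t) / 2 - u * v = (t * u - v) ^+ 2 / (2 * t).
    by field; rewrite lt0r_neq0.
  by rewrite divr_ge0 ?sqr_ge0// mulr_ge0// ltW.
have he : series e @ \oo --> (t * nsq a + nsq b / t) / 2.
  rewrite (_ : series e = (fun n => (t * series (fun k => normC (a k) ^+ 2) n +
     series (fun k => normC (b k) ^+ 2) n / t) / 2)).
    apply: cvgM; last exact: cvg_cst.
    apply: cvgD; apply: cvgM; try exact: cvg_cst; [exact: la|exact: lb].
  apply/funext => n; rewrite /series/= mulr_sumr mulr_suml -big_split/= mulr_suml.
  by apply: eq_bigr.
have ce : cvgn (series e) by apply/cvg_ex; eexists; exact: he.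
have [l al tl] := cvgC_series_dominated ek ce.
have -> : dot a b = l by exact: cvg_lim al.
split=> //; have := tl 0%N; rewrite !big_geq// !subr0; congr (_ <= _).
exact: cvg_lim he.
Qed.

Lemma dot_cvg a b : l2 a -> l2 b ->
  series (fun k => a k * (b k)^*%C) @ \oo --> dot a b.
Proof. by move=> la lb; case: (dot_cvg_le ltr01 la lb). Qed.

Lemma dotE a b (l : R[i]) : series (fun k => a k * (b k)^*%C) @ \oo --> l -> dot a b = l.
Proof. by move=> h; exact: cvg_lim h. Qed.

Lemma dot_linl a b d c : l2 a -> l2 b -> l2 d ->
  dot (fun k => a k + c * b k) d = dot a d + c * dot b d.
Proof.
move=> la lb ld; apply: dotE.
rewrite (_ : series _ = (fun n => series (fun k => a k * (d k)^*%C) n +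
  c * series (fun k => b k * (d k)^*%C) n)).
  apply: cvgD; first exact: dot_cvg.
  by apply: cvgM; [exact: cvg_cst|exact: dot_cvg].
apply/funext => n; rewrite /series/= mulr_sumr -big_split/=.
by apply: eq_bigr => k _; rewrite mulrDl mulrA.
Qed.

Lemma cvgCJ (T : Type) (F : set_system T) {FF : Filter F} (f : T -> R[i])
    (l : R[i]) : f @ F --> l -> (fun x => (f x)^*%C) @ F --> l^*%C.
Proof.
move=> /cvgCP h; apply/cvgCP; under eq_fun do rewrite -rmorphB normCJ.
exact: h.
Qed.

Lemma dotC a b : l2 a -> l2 b -> dot a b = (dot b a)^*%C.
Proof.
move=> la lb; apply: dotE.
rewrite (_ : series _ = (fun n => (series (fun k => b k * (a k)^*%C) n)^*%C)).
  by apply: cvgCJ; exact: dot_cvg.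
apply/funext => n; rewrite /series/= rmorph_sum; apply: eq_bigr => k _.
by rewrite rmorphM /= conjcK mulrC.
Qed.

Lemma cvg_RtoC (T : Type) (F : set_system T) {FF : Filter F} (f : T -> R)
    (l : R) : f @ F --> l -> (fun x => (f x)%:C) @ F --> l%:C.
Proof.
by move=> h; apply: cvgC_ReIm => /=; [exact: h|exact: cvg_cst].
Qed.

Lemma dot_nsq a : l2 a -> dot a a = (nsq a)%:C.
Proof.
move=> la; apply: dotE.
rewrite (_ : series _ = (fun n => (series (fun k => normC (a k) ^+ 2) n)%:C)).
  by apply: cvg_RtoC; exact: la.
apply/funext => n; rewrite /series/= rmorph_sum; apply: eq_bigr => k _.
by rewrite /= normC_sqrJ.
Qed.

Lemma dot_linr a b d c : l2 a -> l2 b -> l2 d ->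
  dot d (fun k => a k + c * b k) = dot d a + c^*%C * dot d b.
Proof.
move=> la lb ld; rewrite dotC ?dot_linl//; last exact: l2_lin.
by rewrite rmorphD rmorphM /= -!dotC.
Qed.

Lemma nsq_lin a b c : l2 a -> l2 b -> nsq (fun k => a k + c * b k) =
  nsq a + normC c ^+ 2 * nsq b + 2 * complex.Re (c^*%C * dot a b).
Proof.
move=> la lb; have ll := l2_lin (c := c) la lb.
apply: complexI; rewrite -dot_nsq// dot_linl// !dot_linr//.
rewrite (@dotC b a)// !dot_nsq// 2!rmorphD /=.
rewrite [X in _ = _ + X + _](_ : _ = c * c^*%C * (nsq b)%:C); last by rewrite rmorphM /= normC_sqrJ.
rewrite [X in _ = _ + X](_ : _ = c^*%C * dot a b + (c^*%C * dot a b)^*%C).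
  rewrite (_ : (c^*%C * dot a b)^*%C = c * (dot a b)^*%C); first by ring.
  by rewrite rmorphM /= conjcK.
by rewrite addcJ rmorphM rmorph_nat.
Qed.

(* Polarization. *)
Lemma dot_eq_of_nsq a b a' b' : l2 a -> l2 b -> l2 a' -> l2 b' ->
  nsq a = nsq a' -> nsq b = nsq b' ->
  (forall c, nsq (fun k => a k + c * b k) = nsq (fun k => a' k + c * b' k)) ->
  dot a b = dot a' b'.
Proof.
move=> la lb la' lb' Ea Eb Eab.
have h c : complex.Re (c * dot a b) = complex.Re (c * dot a' b').
  have := Eab c^*%C; rewrite !nsq_lin// Ea Eb conjcK => /addrI.
  by apply: mulfI; rewrite pnatr_eq0.
have := h 1; have := h 'i%C; case: (dot a b) (dot a' b') => [x y] [x' y'] /=.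
rewrite !mul0r !mul1r !sub0r !subr0 => yy xx.
by congr (_ +i* _); lra.
Qed.

End square_summable.

(** * The Hardy space *)

Section hardy_space.
Variable R : realType.
Implicit Types (f g h phi : disc R -> R[i]) (a b p : nat -> R[i]) (z : disc R) (c : R[i]).

Lemma normC_disc z : normC (disc_val z) < 1.
Proof. by rewrite -normC_lt1; exact: disc_lt1. Qed.

(** Outside the disc the value is the one at 0. The extension keeps any bound of [f] and allows
    expansions at [w + v] to be written on [R[i]]. *)
Definition ext f (w : R[i]) : R[i] := f (insubd (disc0 R) w).

Lemma disc_insubd (w : R[i]) : normC w < 1 -> disc_val (insubd (disc0 R) w) = w.
Proof.
rewrite -normC_lt1 => w1.
by rewrite (_ : disc_val _ = \val (insubd (disc0 R) w))// val_insubd w1.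
Qed.

Lemma ext_disc f z : ext f (disc_val z) = f z.
Proof.
rewrite /ext; congr f; apply: val_inj => /=.
by rewrite disc_insubd// normC_disc.
Qed.

Lemma power_seriesP a f : power_series a f <-> is_ps_at (ext f) 0 1 a.
Proof.
split=> [h w w1|h z].
  by rewrite add0r -(disc_insubd w1) ext_disc; exact: h.
by have := h (disc_val z) (normC_disc z); rewrite add0r ext_disc.
Qed.

Lemma power_series_absconv a f s : power_series a f -> 0 <= s < 1 -> absconv a s.
Proof. by move=> /power_seriesP /is_ps_at_absconv; exact. Qed.

Lemma power_seriesE a f z : power_series a f -> f z = ps a (disc_val z).
Proof. by move=> h; rewrite (psE (h z)). Qed.

Lemma power_series_inj a b f : power_series a f -> power_series b f -> a = b.
Proof.
by move=> /power_seriesP ha /power_seriesP hb; exact: is_ps_at_unique ltr01 ltr01 ha hb.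
Qed.

Lemma power_series_fun a f g : power_series a f -> power_series a g -> f = g.
Proof.
by move=> hf hg; apply/funext => z; rewrite (power_seriesE _ hf) (power_seriesE _ hg).
Qed.

Lemma taylorE a f : power_series a f -> taylor f = a.
Proof.
move=> h; rewrite /taylor; case: xgetP => [b _ hb|/(_ a)]; last by [].
exact: power_series_inj hb h.
Qed.

Lemma H2P f : H2 f <-> l2 (taylor f) /\ power_series (taylor f) f.
Proof.
split=> [[a la ha]|[]]; first by rewrite (taylorE ha).
by exists (taylor f).
Qed.

Lemma power_series_H2 a f : l2 a -> power_series a f -> H2 f.
Proof. by move=> la ha; exists a. Qed.

Lemma l2_power_series a : l2 a -> power_series a (fun z => ps a (disc_val z)).
Proof.
move=> la z; apply: (@ps_cvg _ _ _ (normC (disc_val z))) => //.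
by apply: l2_absconv => //; rewrite normC_ge0 normC_disc.
Qed.

Lemma power_series_lin a b f g c : power_series a f -> power_series b g ->
  power_series (fun k => a k + c * b k) (fun z => f z + c * g z).
Proof.
move=> ha hb z; rewrite (_ : series _ = (fun n =>
  series (fun k => a k * disc_val z ^+ k) n + c * series (fun k => b k * disc_val z ^+ k) n)).
  by apply: cvgD; [exact: ha|apply: cvgM; [exact: cvg_cst|exact: hb]].
apply/funext => n; rewrite /series/= mulr_sumr -big_split/=.
by apply: eq_bigr => k _; rewrite mulrDl mulrA.
Qed.

Lemma H2_lin f g c : H2 f -> H2 g -> H2 (fun z => f z + c * g z).
Proof.
move=> /H2P[lf pf] /H2P[lg pg].
by apply: (power_series_H2 (l2_lin lf lg)); exact: power_series_lin.
Qed.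

Lemma taylor_lin f g c : H2 f -> H2 g ->
  taylor (fun z => f z + c * g z) = (fun k => taylor f k + c * taylor g k).
Proof. by move=> /H2P[lf pf] /H2P[lg pg]; exact/taylorE/power_series_lin. Qed.

Definition shift i p k : R[i] := if (i <= k)%N then p (k - i)%N else 0.

Lemma power_series_shift i p f : power_series p f ->
  power_series (shift i p) (fun z => disc_val z ^+ i * f z).
Proof.
move=> hp z; rewrite (_ : series _ = (fun n => disc_val z ^+ i *
  series (fun k => p k * disc_val z ^+ k) (n - i)%N)).
  apply: cvgM; first exact: cvg_cst.
  by apply: (@cvgn_subn _ (series (fun k => p k * disc_val z ^+ k))); exact: hp.
apply/funext => n; rewrite /series/= mulr_sumr.
have lowi m : (m <= i)%N -> \sum_(0 <= k < m) shift i p k * disc_val z ^+ k = 0.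
  move=> mi; rewrite big_nat_cond big1// => k /andP[/andP[_ km] _].
  by rewrite /shift leqNgt (leq_trans km)//= mul0r.
have [ni|ni] := leqP n i.
  by rewrite lowi// (_ : n - i = 0)%N ?big_geq//; apply/eqP; rewrite subn_eq0.
rewrite (@big_cat_nat _ _ _ i 0 n)//= ?(ltnW ni)// lowi// add0r.
rewrite -{1}(add0n i) big_addn; apply: eq_bigr => j _.
by rewrite /shift leq_addl addnK exprD; ring.
Qed.

Lemma power_series0 : power_series (fun=> 0) (fun=> 0 : R[i]).
Proof.
move=> z; under eq_fun do rewrite mul0r.
rewrite (_ : series _ = cst 0); first exact: cvg_cst.
by apply/funext => n; rewrite /series/= big1.
Qed.

Lemma eq_power_series a b f g : power_series a f -> a =1 b -> f =1 g ->
  power_series b g.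
Proof. by move=> h /funext <- /funext <-. Qed.

Lemma power_series_sum (g : nat -> R[i]) (p : nat -> nat -> R[i])
    (f : nat -> disc R -> R[i]) N :
  (forall i, power_series (p i) (f i)) ->
  power_series (fun k => \sum_(0 <= i < N) g i * p i k)
    (fun z => \sum_(0 <= i < N) g i * f i z).
Proof.
move=> h; elim: N => [|N ih].
  by apply: (eq_power_series power_series0) => x; rewrite big_geq.
by apply: (eq_power_series (power_series_lin ih (h N))) => x; rewrite big_nat_recr.
Qed.

End hardy_space.

(** * Multiplication by an inner function is isometric *)

Section inner_functions.
Variable R : realType.
Local Notation mu := (@lebesgue_measure R).
Implicit Types (f h phi : disc R -> R[i]) (a b p g : nat -> R[i]) (z : disc R) (c : R[i]).

Lemma inner_power_series phi : inner phi -> exists p, power_series p phi.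
Proof.
case=> aphi [M phiM] _.
have [||p /power_seriesP hp] := @is_ps_at_global R (ext phi) M; last by exists p.
  by move=> w; rewrite -normC_le; exact: phiM.
move=> w w1; pose z0 := insubd (disc0 R) w.
have [e e0 [a ha]] := aphi z0.
(* The second bound keeps [w + v] in the disc, away from the default value of [ext]. *)
exists (Num.min e (1 - normC w)); first by rewrite lt_min e0 subr_gt0.
exists a => v; rewrite lt_min ltrBrDl => /andP[ve vw].
have wv : normC (w + v) < 1 by exact: le_lt_trans (normCD _ _) vw.
have := ha (insubd (disc0 R) (w + v)).
rewrite !disc_insubd// [w + v]addrC addrK normC_lt => /(_ ve).
by rewrite /ext [v + w]addrC.
Qed.

Lemma power_series_analytic a f : power_series a f -> analytic f.
Proof.
move=> /power_seriesP ha z0.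
have z1 := normC_disc z0.
exists (1 - normC (disc_val z0)); first by rewrite subr_gt0.
exists (fun n => ps (dcoef a n) (disc_val z0)) => z; rewrite normC_lt => zz.
have := is_ps_at_recenter ha z1 zz.
by rewrite add0r [disc_val z0 + _]addrC subrK ext_disc.
Qed.

(** A sequence increasing to 1, because dominated convergence is stated for sequences; note that its
    first term is 0. *)
Definition radii (m : nat) : R := 1 - (m.+1%:R)^-1.

Lemma radii_ge0 m : 0 <= radii m.
Proof. by rewrite subr_ge0 invf_le1// ler1n. Qed.

Lemma radii_lt1 m : radii m < 1.
Proof. by rewrite ltrBlDr ltrDl invr_gt0. Qed.

Lemma cvg_radii1 : radii @ \oo --> (1 : R).
Proof.
rewrite -[X in _ --> X](subr0 (1 : R)).
by apply: cvgB; [exact: cvg_cst|exact: cvg_harmonic].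
Qed.

Lemma cvg_radii : radii @ \oo --> (1 : R)^'-.
Proof.
move=> A hA; have := cvg_radii1 hA; rewrite /nbhs/=.
by apply: filterS => m; apply; exact: radii_lt1.
Qed.

Lemma radialE (t r : R) : 0 <= r < 1 -> disc_val (radial t r) = r%:C * cis t.
Proof.
move=> /andP[r0 r1]; rewrite /radial -/(cis t) disc_insubd//.
by rewrite Normc.normcM norm_cis mulr1 normC_real ger0_norm.
Qed.

(** Coefficients of the product of the polynomial [trunc_fun g N] and the power series with
    coefficients [p]. *)
Definition trunc_coef p (g : nat -> R[i]) N k := \sum_(0 <= i < N) g i * shift i p k.

Definition trunc_fun (g : nat -> R[i]) N (w : R[i]) := \sum_(0 <= i < N) g i * w ^+ i.

Lemma power_series_trunc p phi g N : power_series p phi ->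
  power_series (trunc_coef p g N) (fun z => trunc_fun g N (disc_val z) * phi z).
Proof.
move=> hp; apply: (@eq_power_series _ _ _ _ _ (@power_series_sum R g (fun i => shift i p)
  (fun i z => disc_val z ^+ i * phi z) N _)) => [i|//|z].
  exact: power_series_shift.
by rewrite /trunc_fun mulr_suml; apply: eq_bigr => i _; rewrite mulrA.
Qed.

Lemma trunc_fun_le g N w : normC w <= 1 ->
  normC (trunc_fun g N w) <= \sum_(0 <= i < N) normC (g i).
Proof.
move=> w1; apply: le_trans (normC_sum _ _ _) _; apply: ler_sum => i _.
rewrite Normc.normcM normCX ler_piMr ?normC_ge0//.
by rewrite exprn_ile1// normC_ge0.
Qed.

Lemma cvg_trunc_fun g N t :
  (fun m => trunc_fun g N ((radii m)%:C * cis t)) @ \oo --> trunc_fun g N (cis t).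
Proof.
apply: cvg_sumr => i _; apply: cvgM; first exact: cvg_cst.
have h : (fun m => (radii m)%:C * cis t) @ \oo --> cis t.
  rewrite -[X in _ --> X]mul1r; apply: cvgM; last exact: cvg_cst.
  by apply: (@cvg_RtoC _ _ _ _ _ 1); exact: cvg_radii1.
elim: i => [|i ih].
  by under eq_fun do rewrite expr0; exact: cvg_cst.
by under eq_fun do rewrite exprS; rewrite exprS; apply: cvgM; [exact: h|exact: ih].
Qed.

(* Dominated convergence along [radii]: this is the only place where the
   boundary behaviour of inner functions is used to compute a norm. *)
Lemma inner_isometry_poly phi p (g : nat -> R[i]) N : inner phi -> power_series p phi ->
  l2 (trunc_coef p g N) /\
  nsq (trunc_coef p g N) = \sum_(0 <= i < N) normC (g i) ^+ 2.
Proof.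
move=> [_ [M phiM] bphi] hp; set q := trunc_coef p g N.
have hq := @power_series_trunc p phi g N hp; rewrite -/q in hq.
pose q_ m := dil (radii m) q.
have cq m : absconv (q_ m) 1.
  apply: absconv_dil; first exact: radii_ge0.
  by apply: (power_series_absconv hq); rewrite radii_ge0 radii_lt1.
have rad m t : ps (q_ m) (cis t) =
    trunc_fun g N ((radii m)%:C * cis t) * phi (radial t (radii m)).
  have rm : 0 <= radii m < 1 by rewrite radii_ge0 radii_lt1.
  by rewrite ps_dil -radialE// -(power_seriesE _ hq).
set S := \sum_(0 <= i < N) normC (g i) ^+ 2.
have lim : (fun m => nsq (q_ m)) @ \oo --> S.
  have pi2 : 2 * pi != 0 :> R by rewrite mulf_neq0 ?gt_eqF ?pi_gt0.
  suff : (fun m => 2 * pi * nsq (q_ m)) @ \oo --> 2 * pi * S.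
    move=> H; have -> : S = (2 * pi)^-1 * (2 * pi * S) by rewrite mulKf.
    have -> : (fun m => nsq (q_ m)) = (fun m => (2 * pi)^-1 * (2 * pi * nsq (q_ m))).
      by apply/funext => m; rewrite mulKf.
    by apply: cvgM; [exact: cvg_cst|exact: H].
  rewrite -(parseval_poly g N).
  under eq_fun do rewrite -(parseval (cq _)).2.
  pose B := \sum_(0 <= i < N) normC (g i).
  apply: (@Rintegral_dominated R (fun m t => normC (ps (q_ m) (cis t)) ^+ 2)
    (fun t => normC (\sum_(0 <= k < N) g k * cis t ^+ k) ^+ 2) ((B * M) ^+ 2)).
  - by move=> m; exact: measurable_sqr_ps_cis.
  - apply: measurable_funTS; apply: continuous_measurable_fun.
    exact: continuous_sqr_normC_poly.
  - move=> m t _; rewrite ger0_norm ?exprn_ge0 ?normC_ge0//.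
    have phile z : normC (phi z) <= M by rewrite -normC_le.
    rewrite lerXn2r// ?nnegrE ?normC_ge0//.
      rewrite mulr_ge0//; last exact: le_trans (normC_ge0 _) (phile (disc0 R)).
      by apply: sumr_ge0 => i _; exact: normC_ge0.
    rewrite rad Normc.normcM ler_pM ?normC_ge0//.
    apply: trunc_fun_le; rewrite Normc.normcM norm_cis mulr1 normC_real.
    by rewrite ger0_norm ?radii_ge0// ltW// radii_lt1.
  - apply: ae_imp bphi => t ht At; have [w /normC_eq1 w1 hw] := ht At.
    have hr : (fun m => phi (radial t (radii m))) @ \oo --> w.
      exact: (cvg_comp _ _ cvg_radii hw).
    have hn : (fun m => normC (ps (q_ m) (cis t))) @ \oo -->
        normC (\sum_(0 <= k < N) g k * cis t ^+ k).
      rewrite -[X in _ --> X]mulr1 -w1 -Normc.normcM.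
      apply: cvgC_norm; under eq_fun do rewrite rad.
      by apply: cvgM; [exact: cvg_trunc_fun|exact: hr].
    by under eq_fun do rewrite expr2; rewrite expr2; apply: cvgM; exact: hn.
(* For [nsq q <= S], finite partial sums pass to the limit in [m]; conversely a dilation decreases
   every modulus, so [nsq (q_ m) <= nsq q] for all [m]. *)
have qS n : \sum_(0 <= k < n) normC (q k) ^+ 2 <= S.
  have h : (fun m => \sum_(0 <= k < n) normC (q_ m k) ^+ 2) @ \oo -->
      \sum_(0 <= k < n) normC (q k) ^+ 2.
    apply: cvg_sumr => k _; under eq_fun do rewrite normC_dil ?radii_ge0// expr2.
    have -> : normC (q k) ^+ 2 = (normC (q k) * 1) * (normC (q k) * 1).
      by rewrite mulr1 expr2.
    have hk : (fun m => normC (q k) * radii m ^+ k) @ \oo --> normC (q k) * 1.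
      apply: cvgM; first exact: cvg_cst.
      rewrite -[X in _ --> X](expr1n _ k).
      exact: (cvg_comp _ _ cvg_radii1 (@exprn_continuous R k 1)).
    by apply: cvgM; exact: hk.
  rewrite -(cvg_lim _ h)// -(cvg_lim _ lim)//; apply: ler_lim.
  - by apply/cvg_ex; eexists; exact: h.
  - by apply/cvg_ex; eexists; exact: lim.
  - by apply: nearW => m; apply: le_nsq; exact: (parseval (cq m)).1.
have [lq nqS] := l2_bounded qS; split=> //; apply/eqP; rewrite eq_le nqS/=.
apply: (cvgn_le_bound lim) => m.
apply: (l2_bounded _).2 => n; apply: le_trans (le_nsq n lq).
apply: ler_sum => k _; rewrite normC_dil ?radii_ge0//.
rewrite lerXn2r ?nnegrE ?normC_ge0 ?mulr_ge0 ?normC_ge0 ?exprn_ge0 ?radii_ge0//.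
by rewrite ler_piMr ?normC_ge0// exprn_ile1 ?radii_ge0// ltW// radii_lt1.
Qed.

End inner_functions.

(** * From polynomials to all of H^2 *)

Section multipliers.
Variable R : realType.
Implicit Types (f h phi : disc R -> R[i]) (a b p g : nat -> R[i]) (z : disc R) (c : R[i]).

Lemma trunc_coefE p g N k : (k < N)%N -> trunc_coef p g N k = trunc_coef p g k.+1 k.
Proof.
move=> kN; rewrite /trunc_coef (@big_cat_nat _ _ _ k.+1 0 N)//=.
rewrite [X in _ + X](_ : _ = 0) ?addr0// big_nat_cond big1// => i /andP[/andP[ki _] _].
by rewrite /shift leqNgt ki mulr0.
Qed.

(** Stated for polynomials and on coefficients, so that it can be proved in [inner_factor] for a
    quotient not yet known to be bounded. *)
Definition contractive p := forall g N, l2 (trunc_coef p g N) /\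
  nsq (trunc_coef p g N) <= \sum_(0 <= i < N) normC (g i) ^+ 2.

Lemma cvg_poly g f z : power_series g f ->
  (fun N => trunc_fun g N (disc_val z)) @ \oo --> f z.
Proof. by move=> h; exact: h. Qed.

(** The [k]-th coefficient of the product involves only [g 0, ..., g k], so it is already that of
    the truncation at [k.+1]. This defines [y], whose partial sums are those of a truncation;
    [tannery] shows that [y] represents the product. *)
Lemma contractive_mul p phi f : power_series p phi -> contractive p -> H2 f ->
  H2 (phi \* f) /\ nsq (taylor (phi \* f)) <= nsq (taylor f).
Proof.
move=> hp cp /H2P[lf pf]; set g := taylor f in lf pf *.
pose y k := trunc_coef p g k.+1 k.
have [ly ny] : l2 y /\ nsq y <= nsq g.
  apply: l2_bounded => n; rewrite (_ : \sum_(0 <= k < n) _ =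
    \sum_(0 <= k < n) normC (trunc_coef p g n k) ^+ 2).
    apply: le_trans (le_nsq n (cp g n).1) _; apply: le_trans (cp g n).2 _.
    exact: le_nsq.
  by apply: eq_big_nat => k /andP[_ kn]; rewrite [in RHS]trunc_coefE.
have hy : power_series y (phi \* f).
  move=> z; pose w := disc_val z.
  have [|||N|Y yY XY] := @tannery R (fun N k => trunc_coef p g N k * w ^+ k)
    (fun k => y k * w ^+ k) (fun N => trunc_fun g N w * phi z)
    (geometric (1 + nsq g) (normC w)).
  - move=> N k; rewrite Normc.normcM normCX /geometric/= ler_wpM2r ?exprn_ge0 ?normC_ge0//.
    apply: le_trans (l2_coef_bounded k (cp g N).1) _; rewrite lerD2l.
    by apply: le_trans (cp g N).2 _; exact: le_nsq.
  - by apply: is_cvg_geometric_series; rewrite ger0_norm ?normC_ge0// normC_disc.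
  - move=> k; apply: cvg_near_cst; exists k.+1 => // N /= kN.
    by rewrite trunc_coefE.
  - exact: (@power_series_trunc _ p phi g N hp z).
  have XY' : (fun N => trunc_fun g N w * phi z) @ \oo --> f z * phi z.
    by apply: cvgM; [exact: cvg_poly|exact: cvg_cst].
  have YE : Y = f z * phi z by exact: (cvg_unique _ XY XY').
  by rewrite /= mulrC -YE; exact: yY.
by rewrite (taylorE hy); split=> //; exact: power_series_H2 ly hy.
Qed.

Definition tail g N k : R[i] := if (N <= k)%N then g k else 0.

Lemma l2_tail g N : l2 g -> l2 (tail g N) /\
  nsq (tail g N) <= nsq g - \sum_(0 <= k < N) normC (g k) ^+ 2.
Proof.
move=> lg; apply: l2_bounded => n.
apply: (@le_trans _ _ (\sum_(0 <= k < N + n) normC (tail g N k) ^+ 2)).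
  apply: nondecreasing_series; rewrite ?leq_addl// => k _ _.
  by rewrite exprn_ge0 ?normC_ge0.
rewrite lerBrDl; apply: le_trans (le_nsq (N + n) lg).
rewrite !(@big_cat_nat _ _ _ N 0 (N + n))//= ?leq_addr// lerD2l.
rewrite [X in X + _](_ : _ = 0) ?add0r; last first.
  rewrite big_nat_cond big1// => k /andP[/andP[_ kN] _].
  have -> : tail g N k = 0 by rewrite /tail leqNgt kN.
  by rewrite Normc.normc0 expr0n.
by rewrite big_nat_cond [leRHS]big_nat_cond; apply: ler_sum => k /andP[/andP[Nk _] _]; rewrite /tail Nk.
Qed.

Lemma power_series_tail g f N : power_series g f ->
  power_series (tail g N) (fun z => f z - trunc_fun g N (disc_val z)).
Proof.
move=> hg z; have h : (fun n => series (fun k => g k * disc_val z ^+ k) n -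
    trunc_fun g N (disc_val z)) @ \oo --> f z - trunc_fun g N (disc_val z).
  by apply: cvgB; [exact: hg|exact: cvg_cst].
apply: cvg_trans h; apply: near_eq_cvg; exists N => // n /= Nn.
rewrite /series/= !(@big_cat_nat _ _ _ N 0 n)//= addrAC subrr add0r.
rewrite [X in X + _](_ : _ = 0) ?add0r; last first.
  rewrite big_nat_cond big1// => k /andP[/andP[_ kN] _].
  by rewrite /tail leqNgt kN/= mul0r.
by apply: eq_big_nat => k /andP[Nk _]; rewrite /tail Nk.
Qed.

Lemma cvg_nsq_tail g : l2 g ->
  (fun N => nsq g - \sum_(0 <= k < N) normC (g k) ^+ 2) @ \oo --> (0 : R).
Proof.
by move=> lg; rewrite -[X in _ --> X](subrr (nsq g)); apply: cvgB; [exact: cvg_cst|exact: lg].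
Qed.

Lemma inner_contractive phi p : inner phi -> power_series p phi -> contractive p.
Proof.
by move=> iphi hp g N; have [l ->] := inner_isometry_poly g N iphi hp.
Qed.

Lemma inner_mul_H2 phi f : inner phi -> H2 f -> H2 (phi \* f).
Proof.
move=> iphi hf; have [p hp] := inner_power_series iphi.
exact: (contractive_mul hp (inner_contractive iphi hp) hf).1.
Qed.

Lemma le_limit_mul (x y : R) : 0 <= y ->
  (forall t, 0 < t < 1 -> x <= y / (1 - t)) -> x <= y.
Proof.
move=> y0 h; rewrite leNgt; apply/negP => yx.
have x0 : 0 < x by exact: le_lt_trans yx.
have tt : 0 < (x - y) / (2 * x) < 1.
  by rewrite divr_gt0 ?mulr_gt0 ?subr_gt0//= ltr_pdivrMr ?mulr_gt0// mul1r; lra.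
have := h _ tt; rewrite ler_pdivlMr; last by rewrite subr_gt0; case/andP: tt.
have -> : x * (1 - (x - y) / (2 * x)) = (x + y) / 2.
  by field; rewrite lt0r_neq0.
by lra.
Qed.

(** For the lower bound, the truncations of [f] are multiplied isometrically and differ from [f] by
    a remainder on which multiplication is contractive. With weight [t] in [l2D], [N] tends to
    infinity before [t] tends to 0. *)
Lemma inner_isometry phi f : inner phi -> H2 f ->
  nsq (taylor (phi \* f)) = nsq (taylor f).
Proof.
move=> iphi hf; have [p hp] := inner_power_series iphi.
have cp := inner_contractive iphi hp.
have [hpf npf] := contractive_mul hp cp hf.
apply: le_anti; apply/andP; split; first exact: npf.
have [lf pf] := (H2P f).1 hf; set g := taylor f in lf pf npf *.
have [lpf ppf] := (H2P _).1 hpf.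
apply: le_limit_mul; first exact: nsq_ge0.
move=> t /andP[t0 t1].
have key N : \sum_(0 <= k < N) normC (g k) ^+ 2 <=
    nsq (taylor (phi \* f)) / (1 - t) +
    (nsq g - \sum_(0 <= k < N) normC (g k) ^+ 2) / t.
  have [lt nt] := l2_tail N lf.
  have pt := @power_series_tail g f N pf.
  pose r z := f z - trunc_fun g N (disc_val z).
  have hr : H2 r by exact: power_series_H2 lt pt.
  have [hpr npr] := contractive_mul hp cp hr.
  rewrite (taylorE pt) in npr.
  have [lpr ppr] := (H2P _).1 hpr.
  rewrite -[leLHS](inner_isometry_poly g N iphi hp).2.
  have -> : trunc_coef p g N = (fun k => taylor (phi \* f) k + -1 * taylor (phi \* r) k).
    apply: (@power_series_inj _ _ _ (fun z => trunc_fun g N (disc_val z) * phi z)).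
      exact: power_series_trunc.
    apply: (eq_power_series (power_series_lin (c := -1) ppf ppr)) => [//|z].
    by rewrite /= /r; ring.
  have [lpr' npr'] := l2Z (-1) lpr.
  rewrite normCN Normc.normc1 expr1n mul1r in npr'.
  have t01 : 0 < t < 1 by rewrite t0.
  apply: le_trans (l2D t01 lpf lpr').2 _.
  rewrite lerD2l npr' ler_wpM2r ?invr_ge0 ?(ltW t0)//.
  exact: le_trans npr nt.
have L : (fun N => nsq (taylor (phi \* f)) / (1 - t) +
    (nsq g - \sum_(0 <= k < N) normC (g k) ^+ 2) / t) @ \oo -->
    nsq (taylor (phi \* f)) / (1 - t) + 0 / t.
  by apply: cvgD; [exact: cvg_cst|apply: cvgM; [exact: cvg_nsq_tail|exact: cvg_cst]].
rewrite mul0r addr0 in L.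
rewrite -(cvg_lim _ L)// -[leLHS](cvg_lim _ lf)//; apply: ler_lim.
- exact: lf.
- by apply/cvg_ex; eexists; exact: L.
- by apply: nearW => N; exact: key.
Qed.

End multipliers.

(** * Projection onto the model space *)

Section projection.
Variable R : realType.
Implicit Types (f h theta phi : disc R -> R[i]) (a b p g : nat -> R[i]) (z : disc R) (c : R[i]).

Lemma l2_0 : l2 (fun=> 0 : R[i]).
Proof.
apply: (l2_bounded (B := 0) _).1 => n; rewrite big1// => i _.
by rewrite Normc.normc0 expr0n.
Qed.

Lemma H2_0 : H2 (fun=> 0 : R[i]).
Proof. by apply: power_series_H2 l2_0 _; exact: power_series0. Qed.

Lemma H2_cst_mul c f : H2 f -> H2 (fun z => c * f z).
Proof.
move=> hf; have := H2_lin c H2_0 hf.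
by rewrite (_ : (fun z => 0 + _) = (fun z => c * f z))//; apply/funext => z; rewrite add0r.
Qed.

Lemma H2_sum (I : Type) (s : seq I) (c : I -> R[i]) (f : I -> disc R -> R[i]) :
  (forall i, H2 (f i)) -> H2 (fun z => \sum_(i <- s) c i * f i z).
Proof.
move=> hf; elim: s => [|i s ih].
  by under eq_fun do rewrite big_nil; exact: H2_0.
under eq_fun do rewrite big_cons addrC.
exact: (H2_lin (c i) ih (hf i)).
Qed.

Lemma H2_dotE f h : H2_dot f h = dot (taylor f) (taylor h).
Proof. by []. Qed.

Lemma H2_dot_linl f h (k : disc R -> R[i]) c : H2 f -> H2 h -> H2 k ->
  H2_dot (fun z => f z + c * h z) k = H2_dot f k + c * H2_dot h k.
Proof.
move=> hf hh hk; rewrite !H2_dotE taylor_lin//.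
have [[lf _] [lh _] [lk _]] := And3 ((H2P _).1 hf) ((H2P _).1 hh) ((H2P _).1 hk).
exact: dot_linl.
Qed.

Lemma l2_lc (s : seq nat) (w : nat -> R[i]) (e : nat -> nat -> R[i]) :
  (forall i, l2 (e i)) -> l2 (fun k => \sum_(i <- s) w i * e i k).
Proof.
move=> le; elim: s => [|i s ih].
  by under eq_fun do rewrite big_nil; exact: l2_0.
under eq_fun do rewrite big_cons addrC.
exact: (l2_lin (c := w i) ih (le i)).
Qed.

Lemma dot_0r a : dot a (fun=> 0) = 0.
Proof.
apply: dotE; under eq_fun do rewrite conjc0 mulr0.
rewrite (_ : series _ = cst 0); first exact: cvg_cst.
by apply/funext => n; rewrite /series/= big1.
Qed.

Lemma dot_sumr a (s : seq nat) (w : nat -> R[i]) (e : nat -> nat -> R[i]) :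
  l2 a -> (forall i, l2 (e i)) ->
  dot a (fun k => \sum_(i <- s) w i * e i k) = \sum_(i <- s) (w i)^*%C * dot a (e i).
Proof.
move=> la le; elim: s => [|i s ih].
  by under eq_fun do rewrite big_nil; rewrite big_nil dot_0r.
under eq_fun do rewrite big_cons addrC.
by rewrite dot_linr//; [rewrite ih big_cons addrC|exact: l2_lc].
Qed.

Lemma l2_shift_le i a : l2 a -> l2 (shift i a) /\ nsq (shift i a) <= nsq a.
Proof.
move=> la; apply: l2_bounded => n.
apply: (@le_trans _ _ (\sum_(0 <= k < i + n) normC (shift i a k) ^+ 2)).
  apply: nondecreasing_series; rewrite ?leq_addl// => k _ _.
  by rewrite exprn_ge0 ?normC_ge0.
rewrite (@big_cat_nat _ _ _ i 0 (i + n))//= ?leq_addr//.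
rewrite [X in X + _](_ : _ = 0) ?add0r; last first.
  rewrite big_nat_cond big1// => k /andP[/andP[_ kN] _].
  have -> : shift i a k = 0 by rewrite /shift leqNgt kN.
  by rewrite Normc.normc0 expr0n.
rewrite -{1}(add0n i) big_addn addKn; apply: le_trans (le_nsq n la).
by apply: ler_sum => k _; rewrite /shift leq_addl addnK.
Qed.

Lemma l2_shift i a : l2 a -> l2 (shift i a).
Proof. by move=> la; case: (l2_shift_le i la). Qed.

Lemma trunc_coefT p g N : trunc_coef p g N = (fun k => \sum_(i <- index_iota 0 N) g i * shift i p k).
Proof. by []. Qed.

(* The coefficients of the image of [f] under the adjoint of multiplication by
   [theta]. *)
Definition adj_coef f theta n : R[i] := dot (taylor f) (shift n (taylor theta)).

Lemma H2_1 : H2 (fun=> 1 : R[i]).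
Proof.
apply: (@power_series_H2 _ (fun k => (k == 0%N)%:R)).
  apply: (l2_bounded (B := 1) _).1 => -[|n]; first by rewrite big_geq.
  rewrite big_nat_recl// eqxx Normc.normc1 expr1n big1 ?addr0// => i _.
  by rewrite Normc.normc0 expr0n.
move=> z; apply: cvg_near_cst; exists 1%N => // -[//|n] _.
rewrite /series/= big_nat_recl// eqxx expr0 mulr1 big1 ?addr0// => i _.
by rewrite mul0r.
Qed.

Lemma inner_H2 theta : inner theta -> H2 theta.
Proof.
move=> it; have := inner_mul_H2 it H2_1.
by rewrite (_ : theta \* _ = theta)//; apply/funext => z; rewrite /= mulr1.
Qed.

Lemma dot_trunc f theta g N : inner theta -> H2 f ->
  dot (taylor f) (trunc_coef (taylor theta) g N) =
  \sum_(0 <= n < N) (g n)^*%C * adj_coef f theta n.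
Proof.
move=> it hf; have [lt _] := (H2P _).1 (inner_H2 it).
have [lf _] := (H2P _).1 hf.
by rewrite trunc_coefT dot_sumr// => i; exact: l2_shift.
Qed.

(** Bessel's inequality for the orthonormal functions theta z^n: the squared distance from [f] to
    its partial sum is [nsq (taylor f)] minus the sum of the squares, and it is nonnegative. *)
Lemma l2_adj_coef f theta : inner theta -> H2 f -> l2 (adj_coef f theta).
Proof.
move=> it hf; have [lf pf] := (H2P _).1 hf.
have [_ pt] := (H2P _).1 (inner_H2 it).
set c := adj_coef f theta.
apply: (l2_bounded (B := nsq (taylor f)) _).1 => N.
have [lc nc] := inner_isometry_poly c N it pt.
have := nsq_ge0 (l2_lin (c := -1) lf lc).
rewrite nsq_lin// nc dot_trunc//.
rewrite (_ : \sum_(0 <= n < N) _ = (\sum_(0 <= n < N) normC (c n) ^+ 2)%:C); last first.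
  by rewrite rmorph_sum; apply: eq_bigr => i _; rewrite /= normC_sqrJ mulrC.
rewrite normCN Normc.normc1 expr1n mul1r.
set S := \sum_(_ <= _ < _) _.
have -> : complex.Re ((-1)^*%C * S%:C) = - S.
  have -> : (-1 : R[i])^*%C = -1 by apply/eqP; rewrite eq_complex /= !oppr0 !eqxx.
  by rewrite mulN1r.
lra.
Qed.

Lemma eq0_of_normC_le (D : R[i]) (A : R) : 0 <= A ->
  (forall t, 0 < t -> normC D <= t * A) -> D = 0.
Proof.
move=> A0 h; apply: Normc.eq0_normc; apply/eqP; rewrite eq_le normC_ge0 andbT.
rewrite leNgt; apply/negP => D0.
have A1 : 0 < A + 1 by rewrite ltr_wpDl.
have tt : 0 < normC D / (A + 1) by rewrite divr_gt0.
have := h _ tt; rewrite mulrAC ler_pdivlMr//.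
by rewrite ler_pM2l// => ?; lra.
Qed.

(** Exact for truncations of [k] by finite linearity ([dot_trunc]). The remainder is estimated by
    [dot_cvg_le] with a fixed weight [t]; the truncation order goes to infinity first, then [t] to
    0. *)
Lemma adjoint f theta (k : disc R -> R[i]) : inner theta -> H2 f -> H2 k ->
  H2_dot f (theta \* k) = dot (adj_coef f theta) (taylor k).
Proof.
move=> it hf hk; rewrite H2_dotE; have [lf pf] := (H2P _).1 hf.
have [lk pk] := (H2P _).1 hk; have [lt pt] := (H2P _).1 (inner_H2 it).
have htk := inner_mul_H2 it hk; have [ltk ptk] := (H2P _).1 htk.
have lc := l2_adj_coef it hf.
set c := adj_coef f theta in lc *; set g := taylor k in lk pk *.
apply/eqP; rewrite -subr_eq0; apply/eqP.
apply: (@eq0_of_normC_le _ (nsq (taylor f) / 2)); first by rewrite divr_ge0// nsq_ge0.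
move=> t t0.
have key N : normC (dot (taylor f) (taylor (theta \* k)) - \sum_(0 <= n < N) c n * (g n)^*%C) <=
    (t * nsq (taylor f) + (nsq g - \sum_(0 <= n < N) normC (g n) ^+ 2) / t) / 2.
  have [ltl ntl] := l2_tail N lk.
  have ptl := @power_series_tail R g k N pk.
  pose r z := k z - trunc_fun g N (disc_val z).
  have hr : H2 r by exact: power_series_H2 ltl ptl.
  have htr := inner_mul_H2 it hr; have [ltr ptr] := (H2P _).1 htr.
  have [lT nT] := inner_isometry_poly g N it pt.
  have -> : taylor (theta \* k) = (fun n => taylor (theta \* r) n + 1 * trunc_coef (taylor theta) g N n).
    apply: (power_series_inj ptk).
    apply: (eq_power_series (power_series_lin (c := 1) ptr (@power_series_trunc R _ _ g N pt))) => [//|z].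
    by rewrite /= /r; ring.
  rewrite dot_linr// conjc1 mul1r dot_trunc//.
  rewrite (_ : \sum_(0 <= n < N) (g n)^*%C * _ = \sum_(0 <= n < N) c n * (g n)^*%C); last first.
    by apply: eq_bigr => i _; rewrite mulrC.
  rewrite addrK; apply: le_trans (dot_cvg_le t0 lf ltr).2 _.
  rewrite ler_wpM2r// lerD2l ler_wpM2r ?invr_ge0 ?(ltW t0)//.
  have E : taylor r = tail g N by exact: (taylorE ptl).
  by apply: le_trans ntl; have := inner_isometry it hr; rewrite E => ->; exact: lexx.
have L1 : (fun N => normC (dot (taylor f) (taylor (theta \* k)) - \sum_(0 <= n < N) c n * (g n)^*%C)) @ \oo -->
    normC (dot (taylor f) (taylor (theta \* k)) - dot c g).
  by apply: cvgC_norm; apply: cvgB; [exact: cvg_cst|exact: dot_cvg].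
have L2 : (fun N => (t * nsq (taylor f) + (nsq g - \sum_(0 <= n < N) normC (g n) ^+ 2) / t) / 2) @ \oo -->
    (t * nsq (taylor f) + 0 / t) / 2.
  apply: cvgM; last exact: cvg_cst.
  apply: cvgD; first exact: cvg_cst.
  by apply: cvgM; [exact: cvg_nsq_tail|exact: cvg_cst].
rewrite mul0r addr0 -mulrA in L2.
rewrite -(cvg_lim _ L1)// -(cvg_lim _ L2)//; apply: ler_lim.
- by apply/cvg_ex; eexists; exact: L1.
- by apply/cvg_ex; eexists; exact: L2.
- by apply: nearW => N; exact: key.
Qed.

Lemma inner_dot theta f (k : disc R -> R[i]) : inner theta -> H2 f -> H2 k ->
  H2_dot (theta \* f) (theta \* k) = H2_dot f k.
Proof.
move=> it hf hk; rewrite !H2_dotE.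
have htf := inner_mul_H2 it hf; have htk := inner_mul_H2 it hk.
have [ltf _] := (H2P _).1 htf; have [ltk _] := (H2P _).1 htk.
have [lf _] := (H2P _).1 hf; have [lk _] := (H2P _).1 hk.
apply: (dot_eq_of_nsq ltf ltk lf lk (inner_isometry it hf) (inner_isometry it hk)).
move=> c; apply: (etrans (congr1 (@nsq R) (esym (taylor_lin c htf htk)))).
apply: (etrans _ (congr1 (@nsq R) (taylor_lin c hf hk))).
apply: (etrans _ (inner_isometry it (H2_lin c hf hk))).
by congr (nsq (taylor _)); apply/funext => z /=; ring.
Qed.

Lemma model_space_decomp theta f : inner theta -> H2 f ->
  exists h (g : disc R -> R[i]), [/\ model_space theta h, H2 g & f = fun z => h z + theta z * g z].
Proof.
move=> it hf; have lc := l2_adj_coef it hf.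
have pc := l2_power_series lc; set g := fun z => _ in pc.
have hg : H2 g by exact: power_series_H2 lc pc.
have htg := inner_mul_H2 it hg.
exists (fun z => f z + -1 * (theta \* g) z), g; split; [|exact: hg|by apply/funext => z /=; ring].
split; first exact: (H2_lin (-1) hf htg).
move=> k hk; have htk := inner_mul_H2 it hk.
rewrite (H2_dot_linl (-1) hf htg htk) (inner_dot it hg hk) (adjoint it hf hk).
by rewrite H2_dotE (taylorE pc) mulN1r subrr.
Qed.

Lemma model_space_lin theta f h c : inner theta -> model_space theta f ->
  model_space theta h -> model_space theta (fun z => f z + c * h z).
Proof.
move=> it [hf of_] [hh oh]; split; first exact: (H2_lin c hf hh).
move=> g hg; have htg := inner_mul_H2 it hg.
by rewrite (H2_dot_linl c hf hh htg) (of_ g hg) (oh g hg) mulr0 addr0.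
Qed.

Lemma H2_dotC f h : H2 f -> H2 h -> H2_dot f h = (H2_dot h f)^*%C.
Proof. by move=> /H2P[lf _] /H2P[lh _]; exact: dotC. Qed.

Lemma H2_dot_eq0 f : H2 f -> H2_dot f f = 0 -> f = fun=> 0.
Proof.
move=> /H2P[lf pf]; rewrite H2_dotE dot_nsq// => /complexI f0.
have t0 : taylor f = fun=> 0 by apply: nsq_eq0; rewrite ?f0.
rewrite t0 in pf; exact: power_series_fun pf (@power_series0 R).
Qed.

(** [H2_proj] is a choice, so uniqueness matters too: the difference of two candidates lies in the
    model space and is orthogonal to itself. *)
Lemma H2_projE theta h (g : disc R -> R[i]) : inner theta -> model_space theta h -> H2 g ->
  H2_proj (model_space theta) (fun z => h z + theta z * g z) = h.
Proof.
move=> it Kh hg; have htg := inner_mul_H2 it hg.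
have hh : H2 h by case: Kh.
have sub_h : (fun z => h z + theta z * g z) - h = theta \* g.
  by apply/funext => z; rewrite !fctE /=; ring.
have orth k : model_space theta k -> H2_dot (theta \* g) k = 0.
  by move=> [hk ok]; rewrite H2_dotC// ok// conjc0.
rewrite /H2_proj; case: xgetP => [h' _ [Kh' oh']|/(_ h)[]]; last first.
  by split; [exact: Kh|move=> k /orth; rewrite sub_h].
have hh' : H2 h' by case: Kh'.
pose d z := h z + -1 * h' z.
have Kd : model_space theta d by exact: (model_space_lin (-1) it Kh Kh').
have hd : H2 d by case: Kd.
have := oh' d Kd.
have -> : (fun z => h z + theta z * g z) - h' = (fun z => d z + 1 * (theta \* g) z).
  by apply/funext => z; rewrite !fctE /= /d; ring.
rewrite (H2_dot_linl 1 hd htg hd) (orth d Kd) mulr0 addr0 => /(H2_dot_eq0 hd) d0.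
apply/funext => z; have := congr1 (fun u => u z) d0.
by rewrite /d mulN1r => /eqP; rewrite subr_eq0 => /eqP.
Qed.

End projection.

(** * Division in the Hardy space *)

Section division.
Variable R : realType.
Implicit Types (f h u v : disc R -> R[i]) (a b p : nat -> R[i]) (z : disc R) (c : R[i]).

(** The weight equals the bound on [beta], so [normC y ^+ 2] gets the factor [t < 1] and recursions
    of this shape can be summed. *)
Lemma sqr_normCDM_le (x beta y : R[i]) (t : R) : normC beta <= t -> 0 < t < 1 ->
  normC (x + beta * y) ^+ 2 <= normC x ^+ 2 / (1 - t) + t * normC y ^+ 2.
Proof.
move=> bt t01; have /andP[t0 _] := t01.
apply: le_trans (sqr_normCD_le x (beta * y) t01) _.
rewrite lerD2l Normc.normcM exprMn ler_pdivrMr// [leRHS]mulrAC.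
rewrite ler_wpM2r ?exprn_ge0 ?normC_ge0// -expr2.
by rewrite lerXn2r ?nnegrE ?normC_ge0// ltW.
Qed.

Lemma cvg_succn : (fun n => n.+1) @ \oo --> \oo.
Proof. by move=> A [N _ hN]; exists N => // n /= Nn; apply: hN; exact: leqW. Qed.

(** Formal coefficients of f / (1 - beta z), meaningful also when [beta] has modulus 1. *)
Fixpoint quot_coef (beta : R[i]) a k : R[i] :=
  if k is k'.+1 then a k + beta * quot_coef beta a k' else a 0%N.

(** Summing [step] bounds the partial sum of [q] by that of [a] over [1 - t] plus [t] times the
    previous partial sum of [q]; absorbing the latter on the left gives the second factor
    [1 - t]. *)
Lemma l2_quot_coef (beta : R[i]) a (t : R) : l2 a -> normC beta <= t -> 0 < t < 1 ->
  l2 (quot_coef beta a) /\ nsq (quot_coef beta a) <= nsq a / (1 - t) ^+ 2.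
Proof.
move=> la bt /andP[t0 t1]; set q := quot_coef beta a.
have t1' : 0 < 1 - t by rewrite subr_gt0.
have step k : normC (q k.+1) ^+ 2 <= normC (a k.+1) ^+ 2 / (1 - t) + t * normC (q k) ^+ 2.
  by apply: sqr_normCDM_le; rewrite ?t0.
have rec n : \sum_(0 <= k < n) normC (q k) ^+ 2 <=
    (\sum_(0 <= k < n) normC (a k) ^+ 2) / (1 - t) + t * \sum_(0 <= k < n.-1) normC (q k) ^+ 2.
  elim: n => [|[|n] ih]; first by rewrite !big_geq// mul0r mulr0 addr0.
    rewrite !big_nat1 big_geq// mulr0 addr0 /= ler_peMr ?exprn_ge0 ?normC_ge0//.
    by rewrite invf_ge1//; lra.
  rewrite big_nat_recr//= [X in X / _]big_nat_recr//= [in X in t * X]big_nat_recr//=.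
  have := step n; move: ih; rewrite /=; set x := \sum_(0 <= k < n.+1) _.
  by rewrite !mulrDl !mulrDr; lra.
apply: l2_bounded => n; rewrite ler_pdivlMr ?exprn_gt0// expr2 mulrA -ler_pdivlMr//.
have h : \sum_(0 <= k < n.-1) normC (q k) ^+ 2 <= \sum_(0 <= k < n) normC (q k) ^+ 2.
  by apply: nondecreasing_series; rewrite ?leq_pred// => k _ _; rewrite exprn_ge0 ?normC_ge0.
have := rec n; have := le_nsq n la.
rewrite -(ler_pM2r (_ : 0 < (1 - t)^-1)) ?invr_gt0//.
move: (\sum_(0 <= k < n) normC (a k) ^+ 2) h => x.
move: (\sum_(0 <= k < n) normC (q k) ^+ 2) (\sum_(0 <= k < n.-1) normC (q k) ^+ 2) => y y' h.
by move=> h1 h2; nra.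
Qed.

Lemma one_sub_mul_neq0 (beta : R[i]) z : normC beta <= 1 -> 1 - beta * disc_val z != 0.
Proof.
move=> b1; rewrite subr_eq0; apply/eqP => /(congr1 (@Normc.normc R)).
rewrite Normc.normc1 Normc.normcM => E.
have : normC beta * normC (disc_val z) < 1; last by rewrite -E ltxx.
by apply: le_lt_trans (normC_disc z); rewrite ler_piMl ?normC_ge0.
Qed.

Lemma power_series_quot (beta : R[i]) a f h : power_series a f ->
  power_series (quot_coef beta a) h -> forall z, f z = (1 - beta * disc_val z) * h z.
Proof.
move=> hf hh z.
have hs := power_series_lin (c := - beta) hh (power_series_shift (i := 1) hh).
have E : (fun k => quot_coef beta a k + - beta * shift 1 (quot_coef beta a) k) = a.
  apply/funext => -[|k]; first by rewrite /shift /= mulr0 addr0.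
  by rewrite /shift /= subn1 /=; ring.
rewrite E in hs; rewrite (power_seriesE z hf) -(power_seriesE z hs) expr1; ring.
Qed.

Lemma H2_div f (beta : R[i]) (t : R) : H2 f -> normC beta <= t -> 0 < t < 1 ->
  let q := fun z => f z / (1 - beta * disc_val z) in
  [/\ H2 q, taylor q = quot_coef beta (taylor f) &
  nsq (taylor q) <= nsq (taylor f) / (1 - t) ^+ 2].
Proof.
move=> /H2P[lf pf] bt t01 q; have [lq nq] := l2_quot_coef lf bt t01.
have pq := l2_power_series lq; have E := power_series_quot pf pq.
have b1 : normC beta <= 1 by apply: le_trans bt _; case/andP: t01 => _ /ltW.
have pq' : power_series (quot_coef beta (taylor f)) q.
  apply: (eq_power_series pq) => [//|z].
  by rewrite /q E mulrC mulrA mulVf ?mul1r// one_sub_mul_neq0.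
by rewrite (taylorE pq'); split=> //; exact: power_series_H2 lq pq'.
Qed.

Lemma H2_mulX f : H2 f -> H2 (fun z => disc_val z * f z) /\
  nsq (taylor (fun z => disc_val z * f z)) <= nsq (taylor f).
Proof.
move=> /H2P[lf pf]; have [ls ns] := l2_shift_le 1 lf.
have ps1 := power_series_shift (i := 1) pf; rewrite (taylorE ps1).
by split; [exact: power_series_H2 ls ps1|exact: ns].
Qed.

Lemma H2_eval_le f z : H2 f -> normC (f z) <= (1 + nsq (taylor f)) / (1 - normC (disc_val z)).
Proof.
move=> /H2P[lf pf]; set x := normC (disc_val z).
have x1 : `|x| < 1 by rewrite ger0_norm ?normC_ge0// normC_disc.
have cg := @cvg_geometric_series R (1 + nsq (taylor f)) x x1.
have [|l al tl] := @cvgC_series_dominated R (fun k => taylor f k * disc_val z ^+ k)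
   (geometric (1 + nsq (taylor f)) x) _ (is_cvg_geometric_series x1).
  move=> k; rewrite Normc.normcM normCX /geometric/= ler_wpM2r ?exprn_ge0 ?normC_ge0//.
  exact: l2_coef_bounded.
have -> : f z = l by exact: (cvg_unique _ (pf z) al).
have := tl 0%N; rewrite !big_geq// !subr0; congr (_ <= _).
exact: cvg_lim cg.
Qed.

(** The quotient has the coefficients [D k.+1], where [D k] is the value at [alpha] of the [k]-fold
    backward shift of [f]. Then [D k = a k + w * D k.+1], and [D 0 = f alpha = 0] makes the constant
    term match. *)
Lemma H2_root f (alpha : disc R) : H2 f -> f alpha = 0 ->
  exists2 h, H2 h & forall z, f z = (disc_val z - disc_val alpha) * h z.
Proof.
move=> /H2P[lf pf] f0; set a := taylor f in lf pf; set w := disc_val alpha.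
have w1 : normC w < 1 by exact: normC_disc.
pose D k := ps (fun j => a (k + j)%N) w.
have cD k : series (fun j => a (k + j)%N * w ^+ j) @ \oo --> D k.
  have ck : absconv (fun j => a (k + j)%N) (normC w).
    apply: (@absconv_bounded _ _ (1 + nsq a) 1); last by rewrite normC_ge0.
    by move=> j; rewrite expr1n mulr1 l2_coef_bounded.
  exact: (ps_cvg ck (lexx _)).
have recD k : D k = a k + w * D k.+1.
  have h : (fun n => series (fun j => a (k + j)%N * w ^+ j) n.+1) @ \oo --> a k + w * D k.+1.
    rewrite (_ : (fun n => _) = (fun n => a k + w * series (fun j => a (k.+1 + j)%N * w ^+ j) n)).
      by apply: cvgD; [exact: cvg_cst|apply: cvgM; [exact: cvg_cst|exact: cD]].
    apply/funext => n; rewrite /series/= big_nat_recl//= addn0 expr0 mulr1 mulr_sumr.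
    by congr (_ + _); apply: eq_bigr => j _; rewrite addSnnS exprS; ring.
  have h' : (fun n => series (fun j => a (k + j)%N * w ^+ j) n.+1) @ \oo --> D k.
    have h0 : (fun n => n.+1) @ \oo --> \oo by exact: cvg_succn.
    exact: (cvg_comp _ _ h0 (cD k)).
  exact: (cvg_unique _ h' h).
pose B := (1 + nsq a) / (1 - normC w).
have DB k : normC (D k) <= B.
  have x1 : `|normC w| < 1 by rewrite ger0_norm ?normC_ge0.
  have [|l al tl] := @cvgC_series_dominated R (fun j => a (k + j)%N * w ^+ j)
     (geometric (1 + nsq a) (normC w)) _ (is_cvg_geometric_series x1).
    move=> j; rewrite Normc.normcM normCX /geometric/= ler_wpM2r ?exprn_ge0 ?normC_ge0//.
    exact: l2_coef_bounded.
  have -> : D k = l by exact: (cvg_unique _ (cD k) al).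
  have := tl 0%N; rewrite !big_geq// !subr0; congr (_ <= _).
  exact: cvg_lim (cvg_geometric_series x1).
(* The midpoint, because the weight must be positive while [w] may be 0. *)
pose t := (1 + normC w) / 2.
have t01 : 0 < t < 1 by have := normC_ge0 w; rewrite /t; lra.
have wt : normC w <= t by rewrite /t; lra.
have /andP[t0 t1] := t01; have t1' : 0 < 1 - t by rewrite subr_gt0.
have step k : normC (D k) ^+ 2 <= normC (a k) ^+ 2 / (1 - t) + t * normC (D k.+1) ^+ 2.
  by rewrite {1}recD; exact: sqr_normCDM_le.
have lD : l2 D.
  apply: (l2_bounded (B := (nsq a / (1 - t) + t * B ^+ 2) / (1 - t)) _).1 => n.
  (* The recursion runs downwards, so shifting the sum brings in the extra term [D n]; the uniform
     bound [B] controls it. *)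
  have rec : \sum_(0 <= k < n) normC (D k) ^+ 2 <=
      (\sum_(0 <= k < n) normC (a k) ^+ 2) / (1 - t) +
      t * (\sum_(0 <= k < n) normC (D k) ^+ 2 + B ^+ 2).
    apply: (@le_trans _ _ ((\sum_(0 <= k < n) normC (a k) ^+ 2) / (1 - t) +
      t * \sum_(0 <= k < n) normC (D k.+1) ^+ 2)).
      rewrite mulr_suml mulr_sumr -big_split/=; apply: ler_sum => k _; exact: step.
    rewrite lerD2l ler_wpM2l ?(ltW t0)//.
    apply: (@le_trans _ _ (\sum_(0 <= k < n.+1) normC (D k) ^+ 2)).
      by rewrite big_nat_recl//= lerDr exprn_ge0 ?normC_ge0.
    rewrite big_nat_recr//= lerD2l lerXn2r ?nnegrE ?normC_ge0//.
    exact: le_trans (normC_ge0 _) (DB 0%N).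
  rewrite ler_pdivlMr//; have := le_nsq n lf; fold a.
  rewrite -(ler_pM2r (_ : 0 < (1 - t)^-1)) ?invr_gt0// => h1.
  by move: rec; rewrite mulrDr; lra.
have lg : l2 (fun k => D k.+1).
  apply: (l2_bounded (B := nsq D) _).1 => n; apply: le_trans (le_nsq n.+1 lD).
  by rewrite big_nat_recl//= lerDr exprn_ge0 ?normC_ge0.
have pg := l2_power_series lg; set g := fun z => _ in pg.
exists g; first exact: power_series_H2 lg pg.
move=> z; have D0 : D 0%N = 0.
  by rewrite -f0; exact: (cvg_unique _ (cD 0%N) (pf alpha)).
have hs := power_series_lin (c := - w) (power_series_shift (i := 1) pg) pg.
have E : (fun k => shift 1 (fun k => D k.+1) k + - w * D k.+1) = a.
  apply/funext => -[|k]; rewrite /shift /=.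
    by have := recD 0%N; rewrite D0 add0r => /eqP; rewrite eq_sym addr_eq0 => /eqP ->; ring.
  by rewrite subn1 /= {1}recD; ring.
rewrite E in hs; rewrite (power_seriesE z pf) -(power_seriesE z hs) expr1; ring.
Qed.

Lemma half_weights_le (x y : R) : x <= y -> y / (1 - 2^-1) + x / 2^-1 <= 4 * y.
Proof.
have -> : 1 - 2^-1 = 2^-1 :> R by field.
by rewrite invrK; lra.
Qed.

(* The case [normC gamma = 1] is the point: [g / (1 - gamma z)] is the limit of
   [g / (1 - tau gamma z)] as [tau] tends to 1, whose norms are bounded because
   multiplication by the inner function [u] is isometric. *)
Lemma H2_div_boundary u f h (gamma : R[i]) : inner u -> H2 f -> H2 h ->
  normC gamma <= 1 ->
  (forall z, (1 - gamma * disc_val z) * f z = u z * h z) ->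
  exists2 q, H2 q & forall z, h z = (1 - gamma * disc_val z) * q z.
Proof.
move=> iu hf hh g1 E; have [lh ph] := (H2P _).1 hh.
set S := nsq (taylor f).
(* The shift of the index excludes the radius 0. *)
pose tau m := radii R m.+1.
have tau01 m : 0 < tau m < 1.
  by rewrite radii_lt1 andbT subr_gt0 invf_lt1// ltr1n.
have bnd m n : \sum_(0 <= k < n) normC (quot_coef ((tau m)%:C * gamma) (taylor h) k) ^+ 2 <= 4 * S.
  have /andP[t0 t1] := tau01 m; set t := tau m in t0 t1 *.
  have bt : normC (t%:C * gamma) <= t.
    by rewrite Normc.normcM normC_real gtr0_norm// ler_piMr// ltW.
  have [hq tq _] := H2_div hh bt (tau01 m).
  have [hy _ ny] := H2_div hf bt (tau01 m).
  set q := fun z => h z / _ in hq tq; set y := fun z => f z / _ in hy ny.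
  have [hxy nxy] := H2_mulX hy.
  set xy := fun z => disc_val z * y z in hxy nxy.
  (* (1 - gamma z) / (1 - t gamma z) = 1 - (1 - t) gamma z / (1 - t gamma z). The factor [1 - t]
     offsets the loss in [H2_div], so both terms have squared norm at most [S], uniformly in [m]. *)
  have Eu : u \* q = (fun z => f z + (- ((1 - t)%:C * gamma)) * xy z).
    apply/funext => z; have nz : 1 - t%:C * gamma * disc_val z != 0.
      by apply: one_sub_mul_neq0; apply: le_trans bt (ltW t1).
    have -> : (1 - t)%:C = 1 - t%:C by rewrite rmorphB.
    rewrite /q /xy /y /= mulrA -E; move: (t%:C) (f z) (disc_val z) nz => T x w nz.
    by field.
  rewrite -tq; have [lq _] := (H2P _).1 hq.
  apply: le_trans (le_nsq n lq) _; rewrite -(inner_isometry iu hq) Eu taylor_lin//.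
  have [[lf' _] [lxy _]] := conj ((H2P _).1 hf) ((H2P _).1 hxy).
  have [lc nc] := l2Z (- ((1 - t)%:C * gamma)) lxy.
  have half : 0 < (2^-1 : R) < 1 by rewrite invr_gt0 ltr0n /= invf_lt1 ?ltr1n.
  have [_ n2] := l2D half lf' lc.
  apply: (le_trans n2).
  rewrite nc normCN Normc.normcM normC_real gtr0_norm ?subr_gt0//.
  have k1 : ((1 - t) * normC gamma) ^+ 2 * nsq (taylor xy) <= S.
    apply: (@le_trans _ _ ((1 - t) ^+ 2 * (S / (1 - t) ^+ 2))).
      have t1' : 0 <= 1 - t by rewrite subr_ge0 ltW.
      apply: ler_pM.
      - by rewrite exprn_ge0// mulr_ge0// normC_ge0.
      - exact: nsq_ge0 lxy.
      - by rewrite lerXn2r ?nnegrE ?mulr_ge0 ?normC_ge0// ler_piMr.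
      - exact: (le_trans nxy ny).
    rewrite mulrC divfK; first exact: lexx.
    by rewrite expf_neq0// subr_eq0 gt_eqF.
  exact: half_weights_le k1.
have lim k : (fun m => quot_coef ((tau m)%:C * gamma) (taylor h) k) @ \oo -->
    quot_coef gamma (taylor h) k.
  elim: k => [|k ih] /=; first exact: cvg_cst.
  apply: cvgD; first exact: cvg_cst.
  apply: cvgM; last exact: ih.
  rewrite -[X in _ --> X]mul1r; apply: cvgM; last exact: cvg_cst.
  apply: (@cvg_RtoC _ _ _ _ _ 1).
  exact: (cvg_comp _ _ cvg_succn (@cvg_radii1 R)).
have [lq _] : l2 (quot_coef gamma (taylor h)) /\ nsq (quot_coef gamma (taylor h)) <= 4 * S.
  apply: l2_bounded => n.
  have L : (fun m => \sum_(0 <= k < n) normC (quot_coef ((tau m)%:C * gamma) (taylor h) k) ^+ 2)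
      @ \oo --> \sum_(0 <= k < n) normC (quot_coef gamma (taylor h) k) ^+ 2.
    apply: cvg_sumr => k _; under eq_fun do rewrite expr2.
    by rewrite expr2; apply: cvgM; apply: cvgC_norm; exact: lim.
  exact: (cvgn_le_bound L).
have pq := l2_power_series lq.
exists (fun z => ps (quot_coef gamma (taylor h)) (disc_val z)).
  exact: power_series_H2 lq pq.
exact: power_series_quot ph pq.
Qed.

End division.

(** * Inner functions and Blaschke factors *)

Section inner_algebra.
Variable R : realType.
Local Notation mu := (@lebesgue_measure R).
Implicit Types (f h u v phi : disc R -> R[i]) (a b p : nat -> R[i]) (z : disc R) (c : R[i]).

Lemma le1_of_exprn_bounded (x B : R) : 0 <= x -> (forall n, x ^+ n <= B) -> x <= 1.
Proof.
move=> x0 h; rewrite leNgt; apply/negP => x1.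
have bern n : 1 + n%:R * (x - 1) <= x ^+ n.
  elim: n => [|n ih]; first by rewrite mul0r addr0 expr0.
  rewrite exprS; apply: le_trans (ler_wpM2l x0 ih); rewrite -subr_ge0 -natr1.
  have -> : x * (1 + n%:R * (x - 1)) - (1 + (n%:R + 1) * (x - 1)) = n%:R * (x - 1) ^+ 2.
    by ring.
  by rewrite mulr_ge0// sqr_ge0.
have xm : 0 < x - 1 by rewrite subr_gt0.
pose n := Num.truncn (B / (x - 1)).
have := truncnS_gt (B / (x - 1)); rewrite ltr_pdivrMr// -/n => Bn.
have := le_trans (bern n.+1) (h n.+1); lra.
Qed.

Lemma nsq1 : nsq (taylor (fun _ : disc R => 1 : R[i])) = 1.
Proof.
have h : power_series (fun k => (k == 0%N)%:R) (fun _ : disc R => 1 : R[i]).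
  move=> z; apply: cvg_near_cst; exists 1%N => // -[//|n] _.
  rewrite /series/= big_nat_recl// eqxx expr0 mulr1 big1 ?addr0// => i _.
  by rewrite mul0r.
rewrite (taylorE h); apply: cvg_lim => //.
apply: cvg_near_cst; exists 1%N => // -[//|n] _.
rewrite /series/= big_nat_recl// eqxx big1 ?addr0// => [|i _].
  by rewrite Normc.normc1 expr1n.
by rewrite Normc.normc0 expr0n.
Qed.

(* The powers of [phi] stay in the unit ball of [H2], so they are bounded at [z]. *)
Lemma contractive_le1 p phi z : power_series p phi -> contractive p -> normC (phi z) <= 1.
Proof.
move=> hp cp.
have h n : H2 (fun z => phi z ^+ n) /\ nsq (taylor (fun z => phi z ^+ n)) <= 1.
  elim: n => [|n [ih1 ih2]].
    by split; [exact: H2_1|rewrite nsq1].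
  have [h1 h2] := contractive_mul hp cp ih1.
  have -> : (fun z => phi z ^+ n.+1) = phi \* (fun z => phi z ^+ n).
    by apply/funext => w; rewrite exprS.
  by split; [exact: h1|exact: (le_trans h2 ih2)].
apply: (@le1_of_exprn_bounded _ ((1 + 1) / (1 - normC (disc_val z)))); first exact: normC_ge0.
move=> n; rewrite -normCX; have [h1 h2] := h n.
apply: (le_trans (H2_eval_le z h1)).
by rewrite ler_wpM2r ?invr_ge0 ?subr_ge0 ?(ltW (normC_disc z))// lerD2l.
Qed.

Lemma inner_le1 phi z : inner phi -> normC (phi z) <= 1.
Proof.
move=> ip; have [p hp] := inner_power_series ip.
exact: contractive_le1 hp (inner_contractive ip hp).
Qed.

Lemma nbhs_left1_radial (t : R) :
  \forall r \near (1 : R)^'-, disc_val (radial t r) = r%:C * cis t.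
Proof.
near=> r; apply: radialE; apply/andP; split; last by near: r; exact: nbhs_left_lt.
by apply: ltW; near: r; apply: nbhs_left_gt.
Unshelve. all: by end_near. Qed.

(* [h] is contractive because [u] is isometric: the norm of [w * h] is the one
   of [u * (w * h) = v * w], hence of [w], for every polynomial [w]. *)
Lemma inner_factor u v h : inner u -> inner v -> H2 h -> v = u \* h -> inner h.
Proof.
move=> iu iv hh E; have [lh ph] := (H2P _).1 hh.
have ch : contractive (taylor h).
  move=> g N; have pt := @power_series_trunc _ _ _ g N ph.
  have lt : l2 (trunc_coef (taylor h) g N).
    by apply: l2_lc => i; exact: l2_shift.
  split=> //; set f := fun z => _ in pt.
  have hf : H2 f by exact: power_series_H2 lt pt.
  have [pv hv] := inner_power_series iv.
  rewrite -(inner_isometry_poly g N iv hv).2 -(taylorE pt) -(inner_isometry iu hf).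
  rewrite -(taylorE (@power_series_trunc _ _ _ g N hv)).
  rewrite le_eqVlt; apply/orP; left; apply/eqP.
  by congr (nsq (taylor _)); apply/funext => z; rewrite E /f /=; ring.
split.
- exact: power_series_analytic ph.
- by exists 1 => z; rewrite normC_le; exact: contractive_le1 ph ch.
case: iu => _ _ bu; case: iv => _ _ bv.
apply: ae_imp (ae_and bu bv) => t [hu hv] At.
have [w1 /normC_eq1 n1 l1] := hu At; have [w2 /normC_eq1 n2 l2] := hv At.
exists (w2 / w1); first by apply/normC_eq1; rewrite Normc.normcM Normc.normcV n1 n2 divr1.
have w10 : w1 != 0 by rewrite -normC_eq0 n1 oner_eq0.
have L : (fun r => v (radial t r) / u (radial t r)) @ 1^'- --> w2 / w1.
  by apply: cvgM; [exact: l2|apply: cvgV; [exact: w10|exact: l1]].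
apply: cvg_trans L; apply: near_eq_cvg.
(* Near the boundary [u] is at distance less than 1 from its unimodular limit, hence nonzero, and
   [h] is there the quotient of [v] by [u]. *)
have /cvgCP /cvgrPdistC_lt /(_ 1 ltr01) := l1.
apply: filterS => r; rewrite subr0 ger0_norm ?normC_ge0// => d1.
have u0 : u (radial t r) != 0.
  by apply/eqP => u0; move: d1; rewrite u0 sub0r normCN n1 ltxx.
by rewrite E /= mulrC mulKf.
Qed.

Lemma inner_mul u v : inner u -> inner v -> inner (u \* v).
Proof.
move=> iu iv; have hv := inner_H2 iv; have [luv puv] := (H2P _).1 (inner_mul_H2 iu hv).
split.
- exact: power_series_analytic puv.
- exists 1 => z; rewrite normC_le Normc.normcM mulr_ile1 ?normC_ge0//; exact: inner_le1.
case: iu => _ _ bu; case: iv => _ _ bv.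
apply: ae_imp (ae_and bu bv) => t [hu hv'] At.
have [w1 /normC_eq1 n1 l1] := hu At; have [w2 /normC_eq1 n2 l2] := hv' At.
exists (w1 * w2); first by apply/normC_eq1; rewrite Normc.normcM n1 n2 mulr1.
by apply: cvgM; [exact: l1|exact: l2].
Qed.

Lemma inner_cst c : normC c = 1 -> inner (fun=> c).
Proof.
move=> c1; have hc : H2 (fun _ : disc R => c).
  have := H2_cst_mul c (@H2_1 R).
  by rewrite (_ : (fun z => c * 1) = fun=> c)//; apply/funext => z; rewrite mulr1.
have [_ pc] := (H2P _).1 hc.
split.
- exact: power_series_analytic pc.
- by exists 1 => z; rewrite normC_le c1.
apply: aeW => t _; exists c; first exact/normC_eq1.
exact: cvg_cst.
Qed.

(** Pointwise cancellation fails at the zeros of [u]; by isometry the norm of [f - h] is that of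
    [u (f - h)], which is 0. *)
Lemma inner_mulI u f h : inner u -> H2 f -> H2 h -> u \* f = u \* h -> f = h.
Proof.
move=> iu hf hh E.
have hd := H2_lin (-1) hf hh; set d := fun z => _ in hd.
have : nsq (taylor (u \* d)) <= 0.
  have -> : u \* d = fun=> 0.
    apply/funext => z; rewrite /d /= mulrDr.
    by have /(congr1 (fun F => F z))/= -> := E; ring.
  rewrite (taylorE (@power_series0 R)); apply: (l2_bounded _).2 => n.
  by rewrite big1// => i _; rewrite Normc.normc0 expr0n.
rewrite (inner_isometry iu hd) => n0.
have [ld pd] := (H2P _).1 hd.
have t0 : taylor d = fun=> 0 by exact: nsq_eq0.
rewrite t0 in pd; have d0 := power_series_fun pd (@power_series0 R).
apply/funext => z; have := congr1 (fun F => F z) d0; rewrite /d.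
by move=> /eqP; rewrite mulN1r subr_eq0 => /eqP.
Qed.

(** Both moduli are at most 1 and their product is 1, so [u] is unimodular at 0. Its constant
    coefficient then exhausts the norm [nsq (taylor u) = 1], and all others vanish. *)
Lemma inner_unit u v : inner u -> inner v -> u \* v = (fun=> 1) ->
  exists2 c, normC c = 1 & u = fun=> c.
Proof.
move=> iu iv E.
have hu := inner_H2 iu; have [lu pu] := (H2P _).1 hu.
have n1 : nsq (taylor u) = 1.
  apply: (etrans _ (etrans (inner_isometry iu (@H2_1 R)) nsq1)).
  by congr (nsq (taylor _)); apply/funext => z; rewrite /= mulr1.
have u1 z : normC (u z) = 1.
  apply/le_anti/andP; split; first exact: inner_le1.
  have e : normC (u z) * normC (v z) = 1.
    rewrite -Normc.normcM -(Normc.normc1 R); congr normC.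
    exact: (congr1 (fun F => F z) E).
  by rewrite -e ler_piMr ?normC_ge0// inner_le1.
have u0 : u (disc0 R) = taylor u 0%N.
  have L : series (fun k => taylor u k * disc_val (disc0 R) ^+ k) @ \oo --> taylor u 0%N.
    apply: cvg_near_cst; exists 1%N => // -[//|n] _.
    rewrite /series/= big_nat_recl// expr0 mulr1 big1 ?addr0// => i _.
    by rewrite expr0n/= mulr0.
  exact: (cvg_unique _ (pu (disc0 R)) L).
exists (taylor u 0%N); first by rewrite -u0.
have uk k : taylor u k.+1 = 0.
  apply/eqP; rewrite -normC_eq0 -sqrf_eq0 eq_le exprn_ge0 ?normC_ge0// andbT.
  have := le_nsq k.+2 lu; rewrite n1 big_nat_recr//= big_nat_recl//= -u0 u1 expr1n.
  have : 0 <= \sum_(0 <= i < k) normC (taylor u i.+1) ^+ 2.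
    by apply: sumr_ge0 => i _; rewrite exprn_ge0 ?normC_ge0.
  move: (\sum_(0 <= i < k) _) (_ ^+ 2) => x y; lra.
apply/funext => z.
have L : series (fun k => taylor u k * disc_val z ^+ k) @ \oo --> taylor u 0%N.
  apply: cvg_near_cst; exists 1%N => // -[//|n] _.
  rewrite /series/= big_nat_recl// expr0 mulr1 big1 ?addr0// => i _.
  by rewrite uk mul0r.
exact: (cvg_unique _ (pu z) L).
Qed.

Definition blaschke_factor (alpha : disc R) : disc R -> R[i] := fun z =>
  (disc_val z - disc_val alpha) / (1 - (disc_val alpha)^*%C * disc_val z).

Lemma normC_conj_disc (alpha : disc R) : normC (disc_val alpha)^*%C < 1.
Proof. by rewrite normCJ normC_disc. Qed.

Lemma H2_div_disc (alpha : disc R) f : H2 f ->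
  H2 (fun z => f z / (1 - (disc_val alpha)^*%C * disc_val z)).
Proof.
move=> hf; set beta := (disc_val alpha)^*%C.
have b1 : normC beta < 1 by exact: normC_conj_disc.
have bt : normC beta <= (1 + normC beta) / 2 by lra.
have t01 : 0 < (1 + normC beta) / 2 < 1 by have := normC_ge0 beta; lra.
by have [] := H2_div hf bt t01.
Qed.

Lemma conj_disc_neq0 (alpha : disc R) z : 1 - (disc_val alpha)^*%C * disc_val z != 0.
Proof. by apply: one_sub_mul_neq0; rewrite ltW// normC_conj_disc. Qed.

Lemma normC_mobius (al w : R[i]) : 1 - al^*%C * w != 0 ->
  1 - normC (w - al) ^+ 2 / normC (1 - al^*%C * w) ^+ 2 =
  (1 - normC al ^+ 2) * (1 - normC w ^+ 2) / normC (1 - al^*%C * w) ^+ 2.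
Proof.
move=> n0.
have N0 : normC (1 - al^*%C * w) ^+ 2 != 0 by rewrite expf_neq0// normC_eq0.
have E : normC (1 - al^*%C * w) ^+ 2 - normC (w - al) ^+ 2 = (1 - normC al ^+ 2) * (1 - normC w ^+ 2).
  by rewrite !sqr_normCE; case: al {n0 N0} => a b; case: w => c d /=; ring.
by rewrite -E mulrBl divff.
Qed.

Lemma inner_blaschke_factor (alpha : disc R) : inner (blaschke_factor alpha).
Proof.
set al := disc_val alpha.
have a1 : normC al < 1 by exact: normC_disc.
have hb : H2 (blaschke_factor alpha).
  apply: (@H2_div_disc alpha (fun z => disc_val z - al)).
  have := H2_lin (- al) (H2_mulX (@H2_1 R)).1 (@H2_1 R).
  rewrite (_ : (fun z => _) = fun z => disc_val z - al)//.
  by apply/funext => z; rewrite !mulr1.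
have [_ pb] := (H2P _).1 hb.
split.
- exact: power_series_analytic pb.
- exists 1 => z; rewrite normC_le -(ler_pXn2r (isT : (0 < 2)%N)) ?nnegrE ?normC_ge0//.
  rewrite expr1n -subr_ge0 Normc.normcM Normc.normcV exprMn exprVn.
  rewrite normC_mobius; last exact: conj_disc_neq0.
  rewrite divr_ge0 ?exprn_ge0 ?normC_ge0// mulr_ge0// subr_ge0 exprn_ile1 ?normC_ge0//.
    exact: ltW.
  by rewrite ltW// normC_disc.
apply: aeW => t _.
have n0 : 1 - al^*%C * cis t != 0.
  rewrite subr_eq0; apply/eqP => /(congr1 (@Normc.normc R)).
  by rewrite Normc.normc1 Normc.normcM norm_cis mulr1 normCJ => E; move: a1; rewrite -E ltxx.
exists ((cis t - al) / (1 - al^*%C * cis t)).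
  apply/normC_eq1/eqP; rewrite -(@eqrXn2 _ 2) ?normC_ge0// expr1n eq_sym -subr_eq0.
  rewrite Normc.normcM Normc.normcV exprMn exprVn.
  rewrite normC_mobius//.
  by rewrite norm_cis expr1n subrr mulr0 mul0r.
have L0 : (fun r : R => r%:C * cis t) @ 1^'- --> cis t.
  rewrite -[X in _ --> X]mul1r; apply: cvgM; last exact: cvg_cst.
  apply: (@cvg_RtoC _ _ _ _ id 1).
  by apply: (@cvg_at_left_filter _ _ id 1); exact: cvg_id.
have L : (fun r : R => (r%:C * cis t - al) / (1 - al^*%C * (r%:C * cis t))) @ 1^'- -->
    (cis t - al) / (1 - al^*%C * cis t).
  apply: cvgM; first by apply: cvgB; [exact: L0|exact: cvg_cst].
  apply: cvgV; first exact: n0.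
  apply: cvgB; first exact: cvg_cst.
  by apply: cvgM; [exact: cvg_cst|exact: L0].
apply: cvg_trans L; apply: near_eq_cvg.
by apply: filterS (nbhs_left1_radial t) => r rE; rewrite /blaschke_factor rE.
Qed.

End inner_algebra.

(** * Finite rank and finite Blaschke products *)

Section linear_algebra.
Variables (K : fieldType) (T : Type).
Implicit Types (V : set (T -> K)).

Lemma lin_closed_sum V (I : Type) (s : seq I) (c : I -> K) (g : I -> T -> K) :
  V (fun=> 0) -> (forall f h c, V f -> V h -> V (fun z => f z + c * h z)) ->
  (forall i, V (g i)) -> V (fun z => \sum_(i <- s) c i * g i z).
Proof.
move=> V0 Vlin Vg; elim: s => [|i s ih].
  by under eq_fun do rewrite big_nil.
under eq_fun do rewrite big_cons addrC.
exact: (Vlin _ _ (c i) ih (Vg i)).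
Qed.

(* The rows of a matrix of maximal rank among those whose rows are coordinates
   of elements of [V] span [V]. *)
Lemma lin_closed_span V (n : nat) (G : 'I_n -> T -> K) :
  V (fun=> 0) -> (forall f h c, V f -> V h -> V (fun z => f z + c * h z)) ->
  (forall f, V f -> exists c : 'I_n -> K, f = fun z => \sum_(i < n) c i * G i z) ->
  exists (m : nat) (g : 'I_m -> T -> K),
    V = [set (fun z => \sum_(i < m) c i * g i z) | c in [set: 'I_m -> K]].
Proof.
move=> V0 Vlin VG.
pose lc (w : 'rV[K]_n) : T -> K := fun z => \sum_(i < n) w 0 i * G i z.
pose good m (A : 'M[K]_(m, n)) := forall i, V (lc (row i A)).
pose P r := `[< exists m (A : 'M[K]_(m, n)), good m A /\ \rank A = r >].
have exP : exists r, P r.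
  by exists 0%N; apply/asboolP; exists 0%N, 0; split; [case|rewrite mxrank0].
have ubP r : P r -> (r <= n)%N by move=> /asboolP[m [A [_ <-]]]; exact: rank_leq_col.
case: (ex_maxnP exP ubP) => r /asboolP[m [A [gA rA]]] rmax.
have sub (w : 'rV[K]_n) : V (lc w) -> (w <= A)%MS.
  move=> Vw; apply/negPn/negP => nwA.
  have : (\rank (col_mx A w) <= r)%N.
    apply: rmax; apply/asboolP; exists (m + 1)%N, (col_mx A w); split=> // i.
    case: (split_ordP i) => j ->; first by rewrite rowKu; exact: gA.
    by rewrite rowKd (_ : row j w = w)//; apply/rowP => k; rewrite mxE !ord1.
  rewrite -addsmxE -rA leqNgt => /negP; apply.
  have : (A < A + w)%MS.
    rewrite /ltmx addsmxSl /=; apply: contra nwA => /(submx_trans (addsmxSr _ _)).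
    exact.
  by rewrite ltmxErank => /andP[].
exists m, (fun i => lc (row i A)); apply/seteqP; split=> [f Vf|f [c _ <-]].
  have [c fc] := VG _ Vf.
  have fw : f = lc (\row_i c i).
    by rewrite fc; apply/funext => z; apply: eq_bigr => i _; rewrite mxE.
  have /submxP[D DA] : (\row_i c i <= A)%MS by apply: sub; rewrite -fw.
  exists (D 0) => //; rewrite fw DA; apply/funext => z.
  rewrite /lc; under eq_bigr do rewrite mulr_sumr.
  rewrite exchange_big; apply: eq_bigr => j _ /=.
  rewrite mxE mulr_suml; apply: eq_bigr => i _; by rewrite mxE mulrA.
exact: lin_closed_sum.
Qed.

Lemma lin_dependent (n : nat) (c : 'I_n.+1 -> 'I_n -> K) :
  exists2 l : 'I_n.+1 -> K, (exists j, l j != 0) &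
    forall i, \sum_(j < n.+1) l j * c j i = 0.
Proof.
pose C := \matrix_(j < n.+1, i < n) c j i.
have : kermx C != 0.
  rewrite kermx_eq0 -row_leq_rank -ltnNge ltnS; exact: rank_leq_col.
move=> /rowV0Pn[v /sub_kermxP vC v0].
exists (v 0).
  by move/rV0Pn : v0.
move=> i; have /matrixP/(_ 0 i) := vC; rewrite !mxE => E; rewrite -[RHS]E.
by apply: eq_bigr => j _; rewrite mxE.
Qed.

End linear_algebra.

(** * The truncated Toeplitz operator and finite Blaschke products *)

Section toeplitz.
Variable R : realType.
Implicit Types (f h u v phi : disc R -> R[i]) (z : disc R) (c : R[i]).

Lemma toeplitz_spec phi theta f : inner phi -> inner theta -> model_space theta f ->
  model_space theta (truncated_toeplitz phi theta f) /\
  exists2 g, H2 g & forall z, phi z * f z = truncated_toeplitz phi theta f z + theta z * g z.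
Proof.
move=> ip it [hf _]; have hpf := inner_mul_H2 ip hf.
have [h [g [Kh hg E]]] := model_space_decomp it hpf.
rewrite /truncated_toeplitz E H2_projE//; split=> //; exists g => // z.
by have := congr1 (fun F => F z) E.
Qed.

Lemma toeplitzE phi theta f h g : inner theta -> model_space theta h -> H2 g ->
  (forall z, phi z * f z = h z + theta z * g z) -> truncated_toeplitz phi theta f = h.
Proof.
move=> it Kh hg E; rewrite /truncated_toeplitz.
have -> : phi \* f = (fun z => h z + theta z * g z) by apply/funext => z; exact: E.
exact: H2_projE.
Qed.

Lemma model_space0 theta : inner theta -> model_space theta (fun=> 0 : R[i]).
Proof.
move=> it; split; first exact: H2_0.
move=> g hg; have htg := inner_mul_H2 it hg.
rewrite (H2_dotC (@H2_0 R) htg) H2_dotE (taylorE (@power_series0 R)) dot_0r.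
exact: conjc0.
Qed.

(** Dividing both sides by 1 - conj(alpha) z turns the common factor into an inner function, so it
    cancels at [alpha] as well. *)
Lemma cancel_root f h (alpha : disc R) : H2 f -> H2 h ->
  (forall z, (disc_val z - disc_val alpha) * f z = (disc_val z - disc_val alpha) * h z) ->
  f = h.
Proof.
move=> hf hh E; apply: (inner_mulI (inner_blaschke_factor alpha) hf hh).
by apply/funext => z; rewrite /blaschke_factor /= mulrAC E mulrAC.
Qed.

Definition blaschke_prod (t : seq (disc R)) : disc R -> R[i] :=
  fun z => \prod_(alpha <- t) blaschke_factor alpha z.

Lemma blaschke_prod_nil z : blaschke_prod [::] z = 1.
Proof. exact: big_nil. Qed.

Lemma blaschke_prod_cons alpha t z :
  blaschke_prod (alpha :: t) z = blaschke_factor alpha z * blaschke_prod t z.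
Proof. exact: big_cons. Qed.

Lemma inner_blaschke_prod t : inner (blaschke_prod t).
Proof.
elim: t => [|alpha t ih].
  rewrite (_ : blaschke_prod [::] = fun=> 1); first by apply: inner_cst; exact: Normc.normc1.
  by apply/funext => z; rewrite blaschke_prod_nil.
rewrite (_ : blaschke_prod _ = blaschke_factor alpha \* blaschke_prod t).
  by apply: inner_mul => //; exact: inner_blaschke_factor.
by apply/funext => z; rewrite blaschke_prod_cons.
Qed.

Lemma H2_mul_sub_conj (alpha : disc R) f : H2 f ->
  H2 (fun z => (1 - (disc_val alpha)^*%C * disc_val z) * f z).
Proof.
move=> hf; have := H2_lin (- (disc_val alpha)^*%C) hf (H2_mulX hf).1.
by rewrite (_ : (fun z => f z + _) = fun z => (1 - (disc_val alpha)^*%C * disc_val z) * f z)//;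
  apply/funext => z; ring.
Qed.

Lemma blaschke_factorE (alpha : disc R) z c : blaschke_factor alpha z *
  ((1 - (disc_val alpha)^*%C * disc_val z) * c) = (disc_val z - disc_val alpha) * c.
Proof. by rewrite /blaschke_factor mulrA divfK// conj_disc_neq0. Qed.

Lemma blaschke_factor_div f (alpha : disc R) : H2 f -> f alpha = 0 ->
  exists2 h, H2 h & f = blaschke_factor alpha \* h.
Proof.
move=> hf f0; have [k hk E] := H2_root hf f0.
exists (fun z => (1 - (disc_val alpha)^*%C * disc_val z) * k z).
  exact: H2_mul_sub_conj.
by apply/funext => z; rewrite /= blaschke_factorE E.
Qed.

(** Newton interpolation with Blaschke factors in place of z - a. *)
Lemma H2_mod_blaschke t f : H2 f -> exists (c : nat -> R[i]) g, H2 g /\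
  forall z, f z = \sum_(0 <= i < size t) c i * blaschke_prod (take i t) z +
                  blaschke_prod t z * g z.
Proof.
elim: t f => [|alpha t ih] f hf.
  exists (fun=> 0), f; split=> // z.
  by rewrite big_geq// blaschke_prod_nil add0r mul1r.
have hc : H2 (fun z => f z + (- f alpha) * 1) := H2_lin (- f alpha) hf (@H2_1 R).
have [|h hh E] := blaschke_factor_div hc (alpha := alpha).
  by rewrite mulr1 subrr.
have [c [g [hg Eg]]] := ih h hh.
exists (fun i => if i is i'.+1 then c i' else f alpha), g; split=> // z.
have := congr1 (fun F => F z) E; rewrite /= mulr1 Eg => /eqP; rewrite subr_eq => /eqP ->.
rewrite big_nat_recl//= blaschke_prod_nil mulr1 blaschke_prod_cons mulrDr mulr_sumr.
rewrite addrC addrA mulrA; congr (_ + _ + _).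
by apply: eq_bigr => i _; rewrite blaschke_prod_cons; ring.
Qed.

Lemma H2_poly_mul (s : seq R[i]) f : H2 f ->
  H2 (fun z => (\prod_(a <- s) (disc_val z - a)) * f z).
Proof.
move=> hf; elim: s => [|a s ih].
  by under eq_fun do rewrite big_nil mul1r.
have := H2_lin (- a) (H2_mulX ih).1 ih.
rewrite (_ : (fun z => _ + _) = (fun z => (\prod_(b <- a :: s) (disc_val z - b)) * f z))//.
by apply/funext => z; rewrite big_cons; ring.
Qed.

(* Roots of modulus at least 1 are removed by [H2_div_boundary]; a root in the
   disc is a zero of [G] or of [u], and in the second case its Blaschke factor
   goes into [t]. *)
Lemma inner_rational_quotient (s : seq R[i]) u v (G : disc R -> R[i]) :
  inner u -> H2 v -> H2 G ->
  (forall z, (\prod_(a <- s) (disc_val z - a)) * v z = u z * G z) ->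
  exists t u' (G' : disc R -> R[i]), [/\ inner u', H2 G', u = blaschke_prod t \* u' & v = u' \* G'].
Proof.
elim: s u G => [|a s ih] u G iu hv hG E.
  exists [::], u, G; split; [exact: iu|exact: hG| |].
    by apply/funext => z; rewrite /= blaschke_prod_nil mul1r.
  by apply/funext => z; rewrite /= -E big_nil mul1r.
set X : disc R -> R[i] := fun z => (\prod_(b <- s) (disc_val z - b)) * v z.
have hX : H2 X := H2_poly_mul s hv.
have EX z : (disc_val z - a) * X z = u z * G z by rewrite -E big_cons /X mulrA.
have [a1|a1] := ltP (normC a) 1; last first.
  have a0 : a != 0 by rewrite -normC_eq0 gt_eqF// (lt_le_trans _ a1).
  have g1 : normC a^-1 <= 1 by rewrite Normc.normcV invf_le1// (lt_le_trans _ a1).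
  (* As z - a = -a (1 - z / a), the root becomes [gamma = a^-1] of modulus at most 1, and the
     constant -a moves to [G]. *)
  have hG' := H2_cst_mul (- a^-1) hG.
  have [z|q hq Eq] := H2_div_boundary iu hX hG' g1.
    by rewrite [RHS]mulrCA -EX; move: (X z) => x; field.
  apply: (ih u q iu hv hq) => z; rewrite -/(X z).
  have nz := one_sub_mul_neq0 z g1.
  apply: (mulfI nz); rewrite [RHS]mulrCA -Eq [RHS]mulrCA -EX.
  by move: (X z) => x; field.
pose alpha := insubd (disc0 R) a.
have aE : disc_val alpha = a by rewrite disc_insubd.
have : u alpha * G alpha == 0 by rewrite -EX aE subrr mul0r.
rewrite mulf_eq0 => /orP[/eqP u0|/eqP G0].
  have [k hk Ek] := blaschke_factor_div (inner_H2 iu) u0.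
  have ik := inner_factor (inner_blaschke_factor alpha) iu hk Ek.
  have hG1 := H2_div_disc alpha hG.
  (* The Blaschke factor of [u] cancels z - alpha; its denominator is bounded away from 0 and goes
     into [G]. *)
  have XE : X = k \* (fun z => G z / (1 - (disc_val alpha)^*%C * disc_val z)).
    apply: (cancel_root (alpha := alpha) hX (inner_mul_H2 ik hG1)) => z.
    rewrite aE EX Ek /= /blaschke_factor aE; ring.
  have [|t [u' [G' [iu' hG' Eu' Ev]]]] := ih k _ ik hv hG1.
    by move=> z; have := congr1 (fun F => F z) XE.
  exists (alpha :: t), u', G'; split; [exact: iu'|exact: hG'| |exact: Ev].
  by apply/funext => z; rewrite Ek Eu' /= blaschke_prod_cons mulrA.
have [k hk Ek] := H2_root hG G0.
apply: (ih u k iu hv hk) => z.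
have XE : X = u \* k.
  apply: (cancel_root (alpha := alpha) hX (inner_mul_H2 iu hk)) => w.
  by rewrite aE EX Ek aE /= mulrCA.
exact: (congr1 (fun F => F z) XE).
Qed.

Lemma inner_quotE f g h : inner g -> inner h -> f = g \* h -> inner_quot f g = h.
Proof.
move=> ig ih E; rewrite /inner_quot; case: xgetP => [h' _ [ih' E']|/(_ h)[]//].
apply: (inner_mulI ig (inner_H2 ih') (inner_H2 ih)).
by rewrite -E'.
Qed.

Lemma finite_blaschke_prod (t : seq (disc R)) c : normC c = 1 ->
  finite_blaschke (blaschke_prod t \* fun=> c).
Proof.
move=> c1; exists c, (size t), (fun i => nth (disc0 R) t i); split; first exact/normC_eq1.
by move=> z; rewrite /= mulrC /blaschke_prod (big_nth (disc0 R)) big_mkord.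
Qed.

Lemma finite_blaschkeP b : finite_blaschke b ->
  exists t c, normC c = 1 /\ b = blaschke_prod t \* fun=> c.
Proof.
case=> c [n [a [/normC_eq1 c1 E]]].
exists [seq a i | i <- enum 'I_n], c; split=> //; apply/funext => z.
by rewrite E /= mulrC /blaschke_prod big_map big_enum.
Qed.

Lemma finite_rank_of_blaschke phi h1 h2 : inner phi -> inner h1 -> inner h2 ->
  finite_blaschke h2 ->
  finite_rank_on (model_space (phi \* h2)) (truncated_toeplitz (phi \* h1) (phi \* h2)).
Proof.
move=> ip ih1 ih2 /finite_blaschkeP[t [zeta [z1 Eh2]]].
set theta := phi \* h2; set psi := phi \* h1.
have it : inner theta := inner_mul ip ih2.
have ips : inner psi := inner_mul ip ih1.
have zeta0 : zeta != 0 by rewrite -normC_eq0 z1 oner_eq0.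
have dec i : exists De : (disc R -> R[i]) * (disc R -> R[i]),
    [/\ model_space theta De.1, H2 De.2 &
     forall z, phi z * blaschke_prod (take i t) z = De.1 z + theta z * De.2 z].
  have hB := inner_H2 (inner_mul ip (inner_blaschke_prod (take i t))).
  have [D [e [KD he E]]] := model_space_decomp it hB.
  by exists (D, e); split=> // z; have := congr1 (fun F => F z) E.
have [De hDe] := choice dec.
have KD i : model_space theta (De i).1 by case: (hDe i).
have He i : H2 (De i).2 by case: (hDe i).
have EDe i z : phi z * blaschke_prod (take i t) z = (De i).1 z + theta z * (De i).2 z.
  by case: (hDe i).
have Klin f h c := @model_space_lin R theta f h c it.
have K0 := model_space0 it.
(* [finite_rank_on] asks for equality with a span, whereas the projections of phi times the partial
   products only give an inclusion; linearity of the image bridges the gap. *)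
apply: (@lin_closed_span _ _ _ (size t) (fun i => (De i).1)).
- have [KT [g hg E]] := toeplitz_spec ips it K0.
  exists (fun=> 0) => //.
  apply: (toeplitzE it K0 (@H2_0 R)) => z; by rewrite !mulr0 addr0.
- move=> _ _ c [f Kf <-] [h Kh <-].
  have [KTf [gf hgf Ef]] := toeplitz_spec ips it Kf.
  have [KTh [gh hgh Eh]] := toeplitz_spec ips it Kh.
  exists (fun z => f z + c * h z); first exact: Klin.
  apply: (toeplitzE it (Klin _ _ c KTf KTh) (H2_lin c hgf hgh)) => z.
  have lin (p x y t1 t2 th a b : R[i]) : p * x = t1 + th * a -> p * y = t2 + th * b ->
      p * (x + c * y) = t1 + c * t2 + th * (a + c * b).
    by move=> e1 e2; rewrite mulrDr e1 mulrCA e2; ring.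
  exact: lin (Ef z) (Eh z).
move=> _ [k Kk <-]; have hk : H2 k by case: Kk.
have [c [g [hg E]]] := H2_mod_blaschke t (inner_mul_H2 ih1 hk).
exists (fun i => c i).
have KS : model_space theta (fun z => \sum_(i < size t) c i * (De i).1 z).
  exact: (@lin_closed_sum _ _ (model_space theta) _ _ (fun i : 'I_(size t) => c i)
    (fun i => (De i).1) K0 Klin (fun i => KD i)).
have HS : H2 (fun z => \sum_(i < size t) c i * (De i).2 z).
  exact: (@H2_sum _ _ _ (fun i : 'I_(size t) => c i) (fun i => (De i).2) (fun i => He i)).
(* The factor [zeta^-1] compensates the unimodular constant by which [h2] differs from
   [blaschke_prod t]. *)
apply: (toeplitzE it KS (H2_lin zeta^-1 HS hg)) => z.
have -> : psi z * k z = phi z * (h1 z * k z) by rewrite /psi /= mulrA.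
rewrite [h1 z * k z]E [theta z * _]mulrDr [phi z * _]mulrDr addrA; congr (_ + _).
  rewrite big_mkord !mulr_sumr -big_split; apply: eq_bigr => i _ /=.
  by rewrite mulrCA EDe mulrDr; congr (_ + _); exact: mulrCA.
rewrite /theta /= Eh2 /= -!mulrA; congr (_ * (_ * _)).
by rewrite mulVKf.
Qed.

Lemma inner_gcd_cofactors_coprime phi u v w : inner phi -> inner u -> inner v -> inner w ->
  (forall g, inner g -> inner_divides g (phi \* (u \* v)) ->
     inner_divides g (phi \* (u \* w)) -> inner_divides g phi) ->
  exists2 c, normC c = 1 & u = fun=> c.
Proof.
move=> ip iu iv iw gcdP.
have ipu := inner_mul ip iu.
have [||k ik E] := gcdP (phi \* u) ipu.
- by exists v => //; apply/funext => z; rewrite /= mulrA.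
- by exists w => //; apply/funext => z; rewrite /= mulrA.
apply: (inner_unit iu ik).
apply: (inner_mulI ip (inner_mul_H2 iu (inner_H2 ik)) (@H2_1 R)).
by apply/funext => z; have := congr1 (fun F => F z) E; rewrite /= mulr1 mulrA => <-.
Qed.

(* The images of the projections of [1, z, ..., z^n] are linearly dependent. *)
Lemma finite_rank_poly_relation phi1 phi2 : inner phi1 -> inner phi2 ->
  finite_rank_on (model_space phi2) (truncated_toeplitz phi1 phi2) ->
  exists2 p : {poly R[i]}, p != 0 &
    exists2 G, H2 G & forall z, p.[disc_val z] * phi1 z = phi2 z * G z.
Proof.
move=> i1 i2 [n [g Tg]].
have dec (j : nat) : exists kg : (disc R -> R[i]) * (disc R -> R[i]),
    [/\ model_space phi2 kg.1, H2 kg.2 &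
     forall z, disc_val z ^+ j = kg.1 z + phi2 z * kg.2 z].
  have hj : H2 (fun z => disc_val z ^+ j).
    have := power_series_shift (i := j) ((H2P _).1 (@H2_1 R)).2.
    move=> /(power_series_H2 (l2_shift (i := j) ((H2P _).1 (@H2_1 R)).1)).
    by rewrite (_ : (fun z => _ * _) = fun z => disc_val z ^+ j)//; apply/funext => z; rewrite mulr1.
  have [k [e [Kk he E]]] := model_space_decomp i2 hj.
  by exists (k, e); split=> // z; have := congr1 (fun F => F z) E.
have [kg hkg] := choice dec.
(* The monomial z^j need not lie in the model space, but it differs from its projection by a
   multiple of [phi2], so the image of the projection is still congruent to phi1 z^j modulo phi2
   H^2. *)
have spec (j : nat) : exists ge : ('I_n -> R[i]) * (disc R -> R[i]), H2 ge.2 /\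
    forall z, phi1 z * disc_val z ^+ j = \sum_(i < n) ge.1 i * g i z + phi2 z * ge.2 z.
  have [Kk he Ez] := hkg j.
  have [_ [e he' Ee]] := toeplitz_spec i1 i2 Kk.
  have : (truncated_toeplitz phi1 phi2 @` model_space phi2) (truncated_toeplitz phi1 phi2 (kg j).1).
    by exists (kg j).1.
  rewrite Tg => -[c _ Ec].
  exists (c, fun z => e z + 1 * (phi1 \* (kg j).2) z); split.
    exact: (H2_lin 1 he' (inner_mul_H2 i1 he)).
  move=> z; rewrite Ez mulrDr Ee -Ec /= mul1r [phi2 z * (_ + _)]mulrDr addrA.
  by congr (_ + _); rewrite mulrCA.
have [ge hge] := choice spec.
have [l [j0 lj0] El] := @lin_dependent R[i] n (fun j i => (ge j).1 i).
exists (\poly_(j < n.+1) l (inord j)).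
  apply: contra lj0 => /eqP p0; have := congr1 (fun q : {poly R[i]} => q`_j0) p0.
  by rewrite coef_poly ltn_ord inord_val coef0 => ->.
exists (fun z => \sum_(j < n.+1) l j * (ge j).2 z).
  exact: (@H2_sum _ _ _ l (fun j : 'I_n.+1 => (ge j).2) (fun j => (hge j).1)).
move=> z; rewrite horner_poly mulr_suml.
rewrite (_ : \sum_(j < n.+1) _ = \sum_(j < n.+1)
    (\sum_(i < n) l j * (ge j).1 i * g i z + phi2 z * (l j * (ge j).2 z))); last first.
  apply: eq_bigr => j _; rewrite inord_val -mulrA [_ * phi1 z]mulrC (hge j).2 mulrDr.
  rewrite [l j * (phi2 z * _)]mulrCA; congr (_ + _).
  by rewrite mulr_sumr; apply: eq_bigr => i _; rewrite mulrA.
rewrite big_split /= -mulr_sumr [X in X + _](_ : _ = 0) ?add0r//.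
rewrite exchange_big big1// => i _ /=.
by rewrite -mulr_suml El mul0r.
Qed.

End toeplitz.

Theorem theorem3p7 (R : realType) (phi1 phi2 phi : disc R -> R[i])
    (inner_phi1 : inner phi1) (inner_phi2 : inner phi2)
    (phi1_neq_phi2 : phi1 <> phi2) (gcd_phi : is_gcd phi phi1 phi2) :
  finite_rank_on (model_space phi2) (truncated_toeplitz phi1 phi2) <->
  finite_blaschke (inner_quot phi2 phi).
Proof.
case: gcd_phi => ip [h1 ih1 E1] [h2 ih2 E2] gcdP.
rewrite (inner_quotE ip ih2 E2); split; last first.
  by rewrite E1 E2; exact: finite_rank_of_blaschke.
move=> /(finite_rank_poly_relation inner_phi1 inner_phi2)[p p0 [G hG EG]].
have [s Es] := closed_field_poly_normal p.
have lc0 : lead_coef p != 0 by rewrite lead_coef_eq0.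
have hG' := H2_cst_mul (lead_coef p)^-1 hG.
have rel z : (\prod_(a <- s) (disc_val z - a)) * h1 z = h2 z * ((lead_coef p)^-1 * G z).
  (* The common factor [phi] may vanish in the disc, so it is cancelled between functions and not
     pointwise. *)
  have rel' : (fun z => (\prod_(a <- s) (disc_val z - a)) * h1 z) =
      h2 \* (fun z => (lead_coef p)^-1 * G z).
    apply: (inner_mulI ip (H2_poly_mul s (inner_H2 ih1)) (inner_mul_H2 ih2 hG')).
    apply/funext => w; have := EG w.
    rewrite E1 E2 Es hornerZ horner_prod.
    under eq_bigr do rewrite hornerXsubC.
    rewrite lead_coefZ (monicP (monic_prod_XsubC _ _ _)) mulr1 /= => e.
    apply: (mulfI lc0); rewrite [RHS](_ : _ = phi w * h2 w * G w).
      by rewrite -e; ring.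
    by field.
  exact: (congr1 (fun F => F z) rel').
have [t [u [w [iu hw E2' E1']]]] := inner_rational_quotient ih2 (inner_H2 ih1) hG' rel.
(* The root removal only yields [w] in H^2; being inner is what makes [phi \* u] an admissible
   common divisor for [gcdP]. *)
have iw := inner_factor iu ih1 hw E1'.
have iB := inner_blaschke_prod t.
have [c c1 uc] : exists2 c, normC c = 1 & u = fun=> c.
  apply: (inner_gcd_cofactors_coprime ip iu iw iB) => g ig.
  rewrite -E1' -E1 (_ : phi \* (u \* blaschke_prod t) = phi2); first exact: gcdP.
  by rewrite E2 E2'; apply/funext => z; rewrite /= [u z * _]mulrC.
by rewrite E2' uc; exact: finite_blaschke_prod.
Qed.
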